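(* For any integers $m\geq k\geq 1$, the 1-morphism $W_k$ of the finitary 2-category $\mathscr{D}^{(m)}$ is co-great for the left cell $\mathcal{L}=\{W_k,S_k\}$.
   Context: Let $\Bbbk$ be an algebraically closed field of characteristic $0$ and $D=\Bbbk[x]/(x^2)$. Fix a small category $\mathcal{C}$ equivalent to the category $D$-mod of finite dimensional left $D$-modules. The 2-category $\mathscr{D}$ has one object $\mathtt{i}$ (identified with $\mathcal{C}$); its 1-morphisms are all endofunctors of $\mathcal{C}$ isomorphic to tensoring $U\otimes_D-$ with a finite dimensional $D$-$D$-bimodule $U$; its 2-morphisms are all natural transformations (i.e. bimodule homomorphisms). Composition of 1-morphisms is $\otimes_D$, the identity $\mathbbm{1}_{\mathtt{i}}$ corresponds to ${}_DD_D$, and bimodules and the corresponding 1-morphisms are denoted by the same symbols. String bimodules, $k\geq 0$: $M_k$ has basis $m_1,\dots,m_{2k+3}$ with $m_{2j}x=m_{2j-1}$, $xm_{2j}=m_{2j+1}$ for $1\leq j\leq k+1$, and $x$ annihilates all $m_{i}$ with $i$ odd from both sides; $N_k=M_k/\mathrm{span}\{m_{2k+3}\}$, $S_k=M_k/\mathrm{span}\{m_1\}$, $W_k=M_k/\mathrm{span}\{m_1,m_{2k+3}\}$. The remaining indecomposable bimodules are $D\otimes_\Bbbk D$ and the band bimodules (including ${}_DD_D$). For indecomposable 1-morphisms (up to isomorphism) write $F\leq_L G$ if $G$ is a direct summand of $H\circ F$ for some $H$, and $F\leq_J G$ if $G$ is a direct summand of $H_1\circ F\circ H_2$ for some $H_1,H_2$;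 left and two-sided cells are the corresponding equivalence classes. The two-sided cells of $\mathscr{D}$ are $\mathcal{J}_{\Bbbk\text{-split}}=\{D\otimes_\Bbbk D,W_0,S_0,N_0\}$, $\mathcal{J}_0=\{M_0\}$, $\mathcal{J}_k=\{W_k,S_k,N_k,M_k\}$ for $k\geq1$, and $\mathcal{J}_{\mathrm{band}}$ (all band bimodules), with $\mathcal{J}_{\Bbbk\text{-split}}>_J\mathcal{J}_0>_J\mathcal{J}_1>_J\mathcal{J}_2>_J\cdots>_J\mathcal{J}_{\mathrm{band}}$. The left cells in $\mathcal{J}_k$, $k\geq1$, are $\{W_k,S_k\}$ and $\{N_k,M_k\}$. For a positive integer $m$, $\mathscr{D}^{(m)}$ is the 2-full 2-subcategory of $\mathscr{D}$ given by the additive closure of all 1-morphisms in all two-sided cells $\mathcal{J}\geq_J\mathcal{J}_m$ together with $\mathbbm{1}_\mathtt{i}$. Let $\mathcal{L}$ be a left cell in a 2-category and $\mathtt{i}$ the object where its 1-morphisms start. A 1-morphism $H$ is co-good for $\mathcal{L}$ (via $\psi$) if there is a 2-morphism $\psi:\mathbbm{1}_\mathtt{i}\to H$ such that for every $F\in\mathcal{L}$ the 2-morphism $F\psi:F\to FH$ is left split, i.e. there is $\xi:FH\to F$ with $\xi\circ_v F\psi=\mathrm{id}_F$ ($\circ_v$ is vertical composition). $H$ is co-great for $\mathcal{L}$ if it is co-good for $\mathcal{L}$ via some $\psi$ and, for any 1-morphism $H'$ (of the same 2-category) which is co-good for $\mathcal{L}$ via $\psi':\mathbbm{1}_\mathtt{i}\to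 H'$, there is a 2-morphism $\gamma:H'\to H$ with $\psi=\gamma\circ_v\psi'$. *)

(* Defs.v *)
From mathcomp Require Import all_boot all_order all_algebra.
From mathcomp Require Import mxtens.

Set Implicit Arguments.
Unset Strict Implicit.
Unset Printing Implicit Defensive.

Import GRing.Theory.
Local Open Scope ring_scope.

(* Conventions.  K is the ground field and D = K[x]/(x^2).  Vectors are row
   vectors and a linear map f acts by v |-> v *m f, so "first f, then g" is
   f *m g.  The Kronecker product A *t B represents the tensor product of the
   maps A and B over K. *)

Section Modules.
Variable K : fieldType.

(* The small category of finite dimensional D-modules: a D-module structure on
   K^n is the square-zero matrix by which x acts. *)
Record dmod := DMod {
  dim : nat;
  xact : 'M[K]_dim;
  xact_sq : xact *m xact = 0 }.

Record dhom (X Y : dmod) := DHom {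
  hom_mx :> 'M[K]_(dim X, dim Y);
  hom_comm : xact X *m hom_mx = hom_mx *m xact Y }.

Lemma dhom_inj (X Y : dmod) (f g : dhom X Y) : f = g :> 'M_(_, _) -> f = g.
Proof.
case: f g => [f fP] [g gP] /= fg; rewrite -fg in gP *.
by rewrite (eq_irrelevance fP gP).
Qed.

Fact did_comm (X : dmod) : xact X *m 1%:M = 1%:M *m xact X.
Proof. by rewrite mulmx1 mul1mx. Qed.
Definition did (X : dmod) : dhom X X := DHom (did_comm X).

Fact dcomp_comm (X Y Z : dmod) (g : dhom Y Z) (f : dhom X Y) :
  xact X *m (f *m g) = f *m g *m xact Z.
Proof. by rewrite mulmxA hom_comm -mulmxA hom_comm mulmxA. Qed.
Definition dcomp (X Y Z : dmod) (g : dhom Y Z) (f : dhom X Y) : dhom X Z :=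
  DHom (dcomp_comm g f).

Fact dzero_sq : (0 : 'M[K]_0) *m (0 : 'M[K]_0) = 0.
Proof. exact: mul0mx. Qed.
Definition dzero : dmod := DMod dzero_sq.

Fact dplus_sq (X Y : dmod) :
  block_mx (xact X) 0 0 (xact Y) *m block_mx (xact X) 0 0 (xact Y) = 0.
Proof.
by rewrite mulmx_block !(mulmx0, mul0mx, addr0, add0r) !xact_sq block_mx0.
Qed.
Definition dplus (X Y : dmod) : dmod := DMod (dplus_sq X Y).

Fact dplus_hom_comm (X X' Y Y' : dmod) (f : dhom X X') (g : dhom Y Y')
    (fg : 'M_(dim (dplus X Y), dim (dplus X' Y')) := block_mx f 0 0 g) :
  xact (dplus X Y) *m fg = fg *m xact (dplus X' Y').
Proof.
by rewrite /fg /= !mulmx_block !(mulmx0, mul0mx, addr0, add0r) !hom_comm. Qed.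
Definition dplus_hom (X X' Y Y' : dmod) (f : dhom X X') (g : dhom Y Y') :
  dhom (dplus X Y) (dplus X' Y') := DHom (dplus_hom_comm f g).

End Modules.

Arguments dzero {K}.

Section Functors.
Variable K : fieldType.
Local Notation dmod := (dmod K).

Record endofunctor := Endofunctor {
  fobj :> dmod -> dmod;
  fmap : forall X Y : dmod, dhom X Y -> dhom (fobj X) (fobj Y);
  fmap_id : forall X : dmod, fmap (did X) = did (fobj X);
  fmap_comp : forall (X Y Z : dmod) (g : dhom Y Z) (f : dhom X Y),
    fmap (dcomp g f) = dcomp (fmap g) (fmap f) }.

Record nattrans (F G : endofunctor) := NatTrans {
  component :> forall X : dmod, dhom (F X) (G X);
  natural : forall (X Y : dmod) (f : dhom X Y),
    dcomp (component Y) (fmap F f) = dcomp (fmap G f) (component X) }.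

Definition fid : endofunctor :=
  @Endofunctor id (fun _ _ f => f) (fun _ => erefl) (fun _ _ _ _ _ => erefl).

Fact fcomp_id (F G : endofunctor) (X : dmod) :
  fmap F (fmap G (did X)) = did (F (G X)).
Proof. by rewrite !fmap_id. Qed.
Fact fcomp_comp (F G : endofunctor) (X Y Z : dmod) (g : dhom Y Z)
    (f : dhom X Y) :
  fmap F (fmap G (dcomp g f)) =
  dcomp (fmap F (fmap G g)) (fmap F (fmap G f)).
Proof. by rewrite !fmap_comp. Qed.
(* fcomp F G applies G first; it corresponds to the tensor product over D of
   the bimodule of F with that of G. *)
Definition fcomp (F G : endofunctor) : endofunctor :=
  @Endofunctor (fun X => F (G X)) (fun X Y f => fmap F (fmap G f))
    (fcomp_id F G) (fcomp_comp F G).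

Fact fzero_id (X : dmod) : did dzero = did dzero :> dhom (@dzero K) dzero.
Proof. by []. Qed.
Fact fzero_comp (X Y Z : dmod) (g : dhom Y Z) (f : dhom X Y) :
  did (@dzero K) = dcomp (did dzero) (did dzero).
Proof. by apply: dhom_inj; rewrite /= mulmx1. Qed.
Definition fzero : endofunctor :=
  @Endofunctor (fun _ => dzero) (fun _ _ _ => did dzero) fzero_id fzero_comp.

Fact fplus_id (F G : endofunctor) (X : dmod) :
  dplus_hom (fmap F (did X)) (fmap G (did X)) = did (dplus (F X) (G X)).
Proof.
by apply: dhom_inj; rewrite /= !fmap_id /= -scalar_mx_block.
Qed.
Fact fplus_comp (F G : endofunctor) (X Y Z : dmod) (g : dhom Y Z)
    (f : dhom X Y) :
  dplus_hom (fmap F (dcomp g f)) (fmap G (dcomp g f)) =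
  dcomp (dplus_hom (fmap F g) (fmap G g)) (dplus_hom (fmap F f) (fmap G f)).
Proof.
apply: dhom_inj; rewrite /= !fmap_comp /=.
by rewrite mulmx_block !(mulmx0, mul0mx, addr0, add0r).
Qed.
Definition fplus (F G : endofunctor) : endofunctor :=
  @Endofunctor (fun X => dplus (F X) (G X))
    (fun X Y f => dplus_hom (fmap F f) (fmap G f))
    (fplus_id F G) (fplus_comp F G).

Definition fsum (s : seq endofunctor) : endofunctor := foldr fplus fzero s.

Definition fiso (F G : endofunctor) : Prop :=
  exists (a : nattrans F G) (b : nattrans G F), forall X : dmod,
    dcomp (b X) (a X) = did (F X) /\ dcomp (a X) (b X) = did (G X).

Fact vcomp_natural (F G H : endofunctor) (b : nattrans G H) (a : nattrans F G)
    (X Y : dmod) (f : dhom X Y) :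
  dcomp (dcomp (b Y) (a Y)) (fmap F f) = dcomp (fmap H f) (dcomp (b X) (a X)).
Proof.
have /(congr1 (@hom_mx _ _ _)) /= eqa := natural a f.
have /(congr1 (@hom_mx _ _ _)) /= eqb := natural b f.
by apply: dhom_inj; rewrite /= mulmxA eqa -!mulmxA eqb.
Qed.
Definition vcomp (F G H : endofunctor) (b : nattrans G H) (a : nattrans F G) :
  nattrans F H := NatTrans (vcomp_natural b a).

Fact whisker_natural (F H : endofunctor) (psi : nattrans fid H) (X Y : dmod)
    (f : dhom X Y) :
  dcomp (fmap F (psi Y)) (fmap F f) = dcomp (fmap (fcomp F H) f) (fmap F (psi X)).
Proof.
have e := congr1 (@fmap F _ _) (natural psi f).
by rewrite !fmap_comp in e.
Qed.
(* The 2-morphism F psi : F = F o 1 -> F o H. *)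
Definition whisker (F H : endofunctor) (psi : nattrans fid H) :
  nattrans F (fcomp F H) :=
  @NatTrans F (fcomp F H) (fun X => fmap F (psi X)) (whisker_natural F psi).

End Functors.

Arguments fid {K}.
Arguments fzero {K}.

(* cokproj T is the quotient map from row vectors of length n onto the cokernel
   of T (row vectors modulo the row space of T), and cokmap T T' A the map
   between cokernels induced by a matrix A that sends the row space of T into
   that of T'. *)
Section Cokernels.
Variable K : fieldType.

Definition cokproj n (T : 'M[K]_n) : 'M[K]_(n, \rank (cokermx T)) :=
  col_base (cokermx T).

Definition cokmap n p (T : 'M[K]_n) (T' : 'M[K]_p) (A : 'M[K]_(n, p)) :
    'M[K]_(\rank (cokermx T), \rank (cokermx T')) :=
  pinvmx (cokproj T) *m A *m cokproj T'.

Lemma mul_cokproj n (T : 'M[K]_n) : T *m cokproj T = 0.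
Proof.
apply: (@row_free_inj _ _ _ _ (row_base (cokermx T)) (row_base_free _)).
by rewrite -mulmxA mulmx_base mul0mx mulmx_coker.
Qed.

Lemma cokprojK n p (T : 'M[K]_n) (B : 'M[K]_(n, p)) :
  T *m B = 0 -> cokproj T *m (pinvmx (cokproj T) *m B) = B.
Proof.
move=> TB0; set Q := cokproj T.
have PQ : pinvmx Q *m Q = 1%:M by rewrite mulVpmx // col_base_full.
have /submxP[C eC] : (1%:M - Q *m pinvmx Q <= T)%MS.
  have QB : cokermx T = Q *m row_base (cokermx T) by rewrite mulmx_base.
  rewrite submxE; apply/eqP; rewrite [X in _ *m X]QB mulmxA.
  by rewrite mulmxBl mul1mx -mulmxA PQ mulmx1 subrr mul0mx.
have := congr1 (mulmx^~ B) eC; rewrite -[C *m T *m B]mulmxA TB0 mulmx0.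
by rewrite mulmxBl mul1mx mulmxA => /eqP; rewrite subr_eq0 => /eqP <-.
Qed.

Lemma cokmap1 n (T : 'M[K]_n) : cokmap T T 1%:M = 1%:M.
Proof. by rewrite /cokmap mulmx1 mulVpmx // col_base_full. Qed.

Lemma cokmap0 n p (T : 'M[K]_n) (T' : 'M[K]_p) : cokmap T T' 0 = 0.
Proof. by rewrite /cokmap mulmx0 mul0mx. Qed.

Lemma cokmapM n p q (T : 'M[K]_n) (T' : 'M[K]_p) (T'' : 'M[K]_q)
    (A : 'M[K]_(n, p)) (B C : 'M[K]_(p, q)) : T' *m B = C *m T'' ->
  cokmap T T' A *m cokmap T' T'' B = cokmap T T'' (A *m B).
Proof.
move=> eB; have e : cokproj T' *m (pinvmx (cokproj T') *m (B *m cokproj T'')) =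
  B *m cokproj T''.
  by rewrite cokprojK // mulmxA eB -mulmxA mul_cokproj mulmx0.
rewrite /cokmap; move: (cokproj T') (cokproj T'') (pinvmx (cokproj T)) e.
move=> Q' Q'' P; move: (pinvmx Q') => P' e.
by rewrite -!mulmxA e.
Qed.

End Cokernels.

Section Bimodules.
Variable K : fieldType.

(* A D-D-bimodule: lact and ract are the matrices of u |-> x u and u |-> u x. *)
Record bimod := Bimod {
  bdim : nat;
  lact : 'M[K]_bdim;
  ract : 'M[K]_bdim;
  lact_sq : lact *m lact = 0;
  ract_sq : ract *m ract = 0;
  lract_comm : lact *m ract = ract *m lact }.

(* The space U (x)_D X is the quotient of U (x)_K X by the span of the vectors
   (u x) (x) v - u (x) (x v), i.e. the cokernel of trel U X. *)
Definition trel (U : bimod) (X : dmod K) : 'M[K]_(bdim U * dim X) :=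
  ract U *t 1%:M - 1%:M *t xact X.

Fact trel_lact (U : bimod) (X : dmod K) :
  trel U X *m (lact U *t 1%:M) = (lact U *t 1%:M) *m trel U X.
Proof.
by rewrite /trel mulmxBl mulmxBr !tensmx_mul !(mulmx1, mul1mx) lract_comm.
Qed.

Fact trel_hom (U : bimod) (X Y : dmod K) (f : dhom X Y) :
  trel U X *m (1%:M *t f) = (1%:M *t f) *m trel U Y.
Proof.
by rewrite /trel mulmxBl mulmxBr !tensmx_mul !(mulmx1, mul1mx) hom_comm.
Qed.

Fact tens_obj_sq (U : bimod) (X : dmod K) (T := trel U X)
    (A := cokmap T T (lact U *t 1%:M)) : A *m A = 0.
Proof.
by rewrite (cokmapM _ _ (trel_lact U X)) tensmx_mul lact_sq tens0mx cokmap0.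
Qed.
Definition tens_obj (U : bimod) (X : dmod K) : dmod K := DMod (tens_obj_sq U X).

Fact tens_hom_comm (U : bimod) (X Y : dmod K) (f : dhom X Y)
    (Uf : 'M_(dim (tens_obj U X), dim (tens_obj U Y)) :=
      cokmap (trel U X) (trel U Y) (1%:M *t f)) :
  xact (tens_obj U X) *m Uf = Uf *m xact (tens_obj U Y).
Proof.
rewrite /Uf /= (cokmapM _ _ (trel_hom U f)) (cokmapM _ _ (trel_lact U Y)).
by rewrite !tensmx_mul !(mulmx1, mul1mx).
Qed.
Definition tens_hom (U : bimod) (X Y : dmod K) (f : dhom X Y) :
  dhom (tens_obj U X) (tens_obj U Y) := DHom (tens_hom_comm U f).

Lemma tensmx11 (n p : nat) : 1%:M *t 1%:M = 1%:M :> 'M[K]_(n * p).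
Proof.
apply/matrixP=> i j; case: (mxtens_indexP i) => i0 i1.
case: (mxtens_indexP j) => j0 j1; rewrite tensmxE !mxE -natrM mulnb.
by rewrite (can_eq (@mxtens_indexK n p)) xpair_eqE.
Qed.

Fact tens_id (U : bimod) (X : dmod K) :
  tens_hom U (did X) = did (tens_obj U X).
Proof. by apply: dhom_inj; rewrite /= tensmx11 cokmap1. Qed.

Fact tens_comp (U : bimod) (X Y Z : dmod K) (g : dhom Y Z) (f : dhom X Y) :
  tens_hom U (dcomp g f) = dcomp (tens_hom U g) (tens_hom U f).
Proof.
by apply: dhom_inj; rewrite /= (cokmapM _ _ (trel_hom U g)) tensmx_mul mulmx1.
Qed.

Definition tens (U : bimod) : endofunctor K :=
  @Endofunctor K (tens_obj U) (@tens_hom U) (@tens_id U) (@tens_comp U).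

(* The bimodule with basis m_a, ..., m_(a+n-1) in which, for i even,
   x m_i = m_(i+1) and m_i x = m_(i-1), basis vectors outside the range being
   read as 0, and x m_i = m_i x = 0 for i odd.  The vector m_(a+i) is the i-th
   standard row vector. *)
Definition string_lact (a n : nat) : 'M[K]_n :=
  \matrix_(i, j) (~~ odd (a + i) && (j == i.+1 :> nat))%:R.
Definition string_ract (a n : nat) : 'M[K]_n :=
  \matrix_(i, j) (~~ odd (a + i) && (i == j.+1 :> nat))%:R.

Lemma string_mul0 (a n : nat) (p q : nat -> nat -> bool) :
  (forall i j, p i j -> (j == i.+1) || (i == j.+1)) ->
  (\matrix_(i < n, j < n) (~~ odd (a + i) && p i j)%:R : 'M[K]_n) *m
  (\matrix_(i < n, j < n) (~~ odd (a + i) && q i j)%:R : 'M[K]_n) = 0.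
Proof.
move=> pP; apply/matrixP=> i j; rewrite !mxE big1 // => l _; rewrite !mxE.
case: (boolP (odd (a + i))) => [_|ev]; first by rewrite mul0r.
case: (boolP (p i l)) => [/pP|_]; last by rewrite mul0r.
suff h : odd (l : nat) = ~~ odd i -> odd (a + l).
  by case/orP=> /eqP e; rewrite h ?mulr0 // e /= ?negbK.
by move=> e; move: ev; rewrite !oddD e; case: (odd a); case: (odd i).
Qed.

Fact string_lact_sq (a n : nat) : string_lact a n *m string_lact a n = 0.
Proof.
exact: (@string_mul0 a n (fun i j => j == i.+1) (fun i j => j == i.+1))
  (fun i j e => introT orP (or_introl e)).
Qed.
Fact string_ract_sq (a n : nat) : string_ract a n *m string_ract a n = 0.
Proof.
exact: (@string_mul0 a n (fun i j => i == j.+1) (fun i j => i == j.+1))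
  (fun i j e => introT orP (or_intror e)).
Qed.
Fact string_comm (a n : nat) :
  string_lact a n *m string_ract a n = string_ract a n *m string_lact a n.
Proof.
rewrite (@string_mul0 a n (fun i j => j == i.+1) (fun i j => i == j.+1)
  (fun i j e => introT orP (or_introl e))).
by rewrite (@string_mul0 a n (fun i j => i == j.+1) (fun i j => j == i.+1)
  (fun i j e => introT orP (or_intror e))).
Qed.
Definition string_bimod (a n : nat) : bimod :=
  Bimod (string_lact_sq a n) (string_ract_sq a n) (string_comm a n).

(* M_k has basis m_1, ..., m_(2k+3); its quotients by m_(2k+3), by m_1 and by
   both have the remaining m_i as basis. *)
Definition Mk (k : nat) : bimod := string_bimod 1 (2 * k + 3).
Definition Nk (k : nat) : bimod := string_bimod 1 (2 * k + 2).
Definition Sk (k : nat) : bimod := string_bimod 2 (2 * k + 2).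
Definition Wk (k : nat) : bimod := string_bimod 2 (2 * k + 1).

End Bimodules.

Section TwoCategory.
Variable K : fieldType.
Local Notation endofunctor := (endofunctor K).

(* The 1-morphisms of the 2-category of endofunctors isomorphic to tensoring
   with a finite dimensional bimodule.  Its 2-morphisms are all natural
   transformations, so a 2-full 2-subcategory is just a class of 1-morphisms. *)
Definition one_mor (F : endofunctor) : Prop :=
  exists U : bimod K, fiso F (tens U).

Definition indecomposable (F : endofunctor) : Prop :=
  [/\ one_mor F, ~ fiso F fzero &
    forall A B : endofunctor, one_mor A -> one_mor B -> fiso F (fplus A B) ->
      fiso A fzero \/ fiso B fzero].

Definition summand (F G : endofunctor) : Prop :=
  exists F' : endofunctor, one_mor F' /\ fiso G (fplus F F').

Definition leJ (F G : endofunctor) : Prop :=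
  exists H1 H2 : endofunctor,
    [/\ one_mor H1, one_mor H2 & summand G (fcomp H1 (fcomp F H2))].

(* Up to isomorphism, the two-sided cell J_m (for m >= 1). *)
Definition cellJ (m : nat) (F : endofunctor) : Prop :=
  [\/ fiso F (tens (Wk K m)), fiso F (tens (Sk K m)),
      fiso F (tens (Nk K m)) | fiso F (tens (Mk K m))].

(* Indecomposables lying in a two-sided cell >=_J J_m, together with the
   identity. *)
Definition Dm_gen (m : nat) (G : endofunctor) : Prop :=
  (indecomposable G /\ exists2 F, cellJ m F & leJ F G) \/ fiso G fid.

Definition Dm (m : nat) (H : endofunctor) : Prop :=
  one_mor H /\
  exists s : seq endofunctor,
    (forall i : 'I_(size s), Dm_gen m (nth fzero s i)) /\ fiso H (fsum s).

(* Up to isomorphism, the left cell {W_k, S_k} (for k >= 1). *)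
Definition cellL_WS (k : nat) (F : endofunctor) : Prop :=
  fiso F (tens (Wk K k)) \/ fiso F (tens (Sk K k)).

Definition left_split (F G : endofunctor) (a : nattrans F G) : Prop :=
  exists xi : nattrans G F, forall X, vcomp xi a X = did (F X).

(* In the next two definitions C is the class of 1-morphisms of the ambient
   2-category. *)
Definition co_good_via (C L : endofunctor -> Prop) (H : endofunctor)
    (psi : nattrans fid H) : Prop :=
  C H /\ forall F : endofunctor, L F -> left_split (whisker F psi).

Definition co_great (C L : endofunctor -> Prop) (H : endofunctor) : Prop :=
  exists psi : nattrans fid H,
    co_good_via C L psi /\
    forall (H' : endofunctor) (psi' : nattrans fid H'),
      co_good_via C L psi' ->
      exists gamma : nattrans H' H, forall X, psi X = vcomp gamma psi' X.

End TwoCategory.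

(* Main.v *)
Require Import Defs.
From mathcomp Require Import all_boot all_order all_algebra.
From mathcomp Require Import mxtens zify.

Set Implicit Arguments.
Unset Strict Implicit.
Unset Printing Implicit Defensive.

(* dim denotes the dimension of a dmod below *)
Import GRing.Theory Defs.
Local Open Scope ring_scope.

(** The argument rests on two observations.

    A co-good 1-morphism that itself lies in the left cell is automatically
    co-great ([co_good_member_co_great]).  Let H be co-good via psi and H' via
    psi'.  Since H is in the cell, H psi' has a left inverse xi : H H' -> H, and
    the composite of psi H' : H' -> H H' with xi is the required comparison
    gamma : H' -> H; gamma o psi' = psi is the interchange law.  So it is enough
    that W_k is co-good and belongs to the 2-subcategory.

    A left inverse of V -> V (x)_D W_k, v |-> v (x) u, is by adjunction a
    bimodule map from W_k to the left linear endomorphisms of V that sends u to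
    the identity ([whisker_split]).  For u = m_2 + m_4 + ... + m_(2k+2) and V
    one of W_k and S_k, let m_(2j) act on V as the projection onto the left
    submodule spanned by m_(2j) and m_(2j+1).  These submodules decompose V, so
    u acts as the identity, and the relation x m_(2j) = m_(2j+2) x of W_k holds
    because right multiplication by x on V lowers the index j of these
    submodules by one ([W_unit_split]).

    For the membership, the same splitting for an index m >= k makes W_k a
    direct summand of W_k W_m ([leJ_W]), and W_k is indecomposable because an
    endomorphism of it is a scalar plus a square-zero map ([W_idempotent]).
    That complements of summands and composites are again 1-morphisms follows
    from the Eilenberg-Watts theorem: the 1-morphisms are the right exact linear
    functors ([right_exact_one_mor]).  The same theory reduces statements about
    natural transformations to their components at D ([nattrans_regD_inj],
    [extension]). *)

(** * Slices of a Kronecker product *)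

Section Stacks.
Variable K : fieldType.

(** [tinj a i] is the map w |-> w (x) e_i from K^a to K^a (x) K^n, [tprj a i]
    the corresponding projection, and [stack M] the map w (x) e_i |-> w M_i.
    They replace the index bookkeeping for maps out of a Kronecker product. *)
Definition tinj a n (i : 'I_n) : 'M[K]_(a, a * n) :=
  \matrix_(r, c) (c == mxtens_index (r, i))%:R.
Definition tprj a n (i : 'I_n) : 'M[K]_(a * n, a) := (tinj a i)^T.
Definition stack a b n (M : 'I_n -> 'M[K]_(a, b)) : 'M[K]_(a * n, b) :=
  \sum_i tprj a i *m M i.

Lemma tinjE a b n (i : 'I_n) (A : 'M[K]_(a * n, b)) r c :
  (tinj a i *m A) r c = A (mxtens_index (r, i)) c.
Proof.
rewrite mxE (bigD1 (mxtens_index (r, i))) //= mxE eqxx mul1r.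
by rewrite big1 ?addr0 // => l /negPf hl; rewrite mxE hl mul0r.
Qed.

Lemma tinj_ext a b n (A B : 'M[K]_(a * n, b)) :
  (forall i, tinj a i *m A = tinj a i *m B) -> A = B.
Proof.
move=> h; apply/matrixP=> r c; case: (mxtens_indexP r) => r0 i.
by rewrite -!tinjE h.
Qed.

Lemma tinj_prj a n (i j : 'I_n) : tinj a i *m tprj a j = (i == j)%:R%:M.
Proof.
apply/matrixP=> r c; rewrite tinjE !mxE (can_eq (@mxtens_indexK a n)) xpair_eqE.
by case: (i == j); rewrite ?andbF ?mul0rn ?andbT.
Qed.

Lemma tinj_stack a b n (M : 'I_n -> 'M[K]_(a, b)) i :
  tinj a i *m stack M = M i.
Proof.
rewrite mulmx_sumr (bigD1 i) //= mulmxA tinj_prj eqxx mul1mx.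
rewrite big1 ?addr0 // => j /negPf hj.
by rewrite mulmxA tinj_prj eq_sym hj mul_scalar_mx scale0r.
Qed.

Lemma stack_tinj a n : stack (tinj a (n := n)) = 1%:M.
Proof. by apply: tinj_ext => i; rewrite tinj_stack mulmx1. Qed.

Lemma tinj_tensl a b n i (A : 'M[K]_(a, b)) :
  tinj a i *m (A *t 1%:M) = A *m tinj b i :> 'M_(a, b * n).
Proof.
apply/matrixP=> r c; rewrite tinjE; case: (mxtens_indexP c) => c0 j.
rewrite tensmxE [RHS]mxE (bigD1 c0) //= big1 ?addr0; last first.
  move=> l hl; rewrite mxE (can_eq (@mxtens_indexK _ _)) xpair_eqE eq_sym.
  by rewrite (negPf hl) mulr0.
by rewrite !mxE (can_eq (@mxtens_indexK _ _)) xpair_eqE eqxx /= eq_sym.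
Qed.

Lemma tinj_tensr a n p i (B : 'M[K]_(n, p)) :
  tinj a i *m (1%:M *t B) = \sum_j B i j *: tinj a j.
Proof.
apply/matrixP=> r c; rewrite tinjE; case: (mxtens_indexP c) => c0 j.
rewrite tensmxE summxE (bigD1 j) //= big1 ?addr0; last first.
  move=> l hl; rewrite !mxE (can_eq (@mxtens_indexK _ _)) xpair_eqE.
  by rewrite [_ == l]eq_sym (negPf hl) andbF mulr0.
by rewrite !mxE (can_eq (@mxtens_indexK _ _)) xpair_eqE eqxx andbT mulrC eq_sym.
Qed.

Lemma tensl_stack a b c n (A : 'M[K]_(a, b)) (M : 'I_n -> 'M[K]_(b, c)) :
  (A *t 1%:M) *m stack M = stack (fun i => A *m M i).
Proof.
by apply: tinj_ext => i; rewrite mulmxA tinj_tensl -mulmxA !tinj_stack.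
Qed.

Lemma tensr_stack a b n p (B : 'M[K]_(n, p)) (M : 'I_p -> 'M[K]_(a, b)) :
  (1%:M *t B) *m stack M = stack (fun i => \sum_j B i j *: M j).
Proof.
apply: tinj_ext => i; rewrite mulmxA tinj_tensr mulmx_suml tinj_stack.
by apply: eq_bigr => j _; rewrite -scalemxAl tinj_stack.
Qed.

Lemma stack_mul a b c n (M : 'I_n -> 'M[K]_(a, b)) (C : 'M[K]_(b, c)) :
  stack M *m C = stack (fun i => M i *m C).
Proof. by rewrite mulmx_suml; apply: eq_bigr => i _; rewrite mulmxA. Qed.

Lemma eq_stack a b n (M N : 'I_n -> 'M[K]_(a, b)) : M =1 N -> stack M = stack N.
Proof. by move=> h; apply: eq_bigr => i _; rewrite h. Qed.

Lemma stackB a b n (M N : 'I_n -> 'M[K]_(a, b)) :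
  stack M - stack N = stack (fun i => M i - N i).
Proof. by rewrite -sumrB; apply: eq_bigr => i _; rewrite mulmxBr. Qed.

End Stacks.

(** * Cokernels of matrices *)

Section Cokernels.
Variable K : fieldType.

(** Equational exactness of [t] followed by [q], with a K-linear section [s] of
    [q] and a K-linear lift [w] of the projection [1 - q s] through [t]; for
    module maps [t] and [q], neither has to commute with x.  Equations are
    easily carried along tensor products over K and retracts. *)
Definition is_cokernel a b c (t : 'M[K]_(a, b)) (q : 'M[K]_(b, c)) : Prop :=
  t *m q = 0 /\ exists s w, s *m q = 1%:M /\ q *m s + w *m t = 1%:M.

Lemma cokernel_factor a b c d (t : 'M[K]_(a, b)) (q : 'M[K]_(b, c))
    (B : 'M[K]_(b, d)) :
  is_cokernel t q -> t *m B = 0 -> q *m (pinvmx q *m B) = B.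
Proof.
case=> _ [s [w [sq e]]] tB.
have full : row_full q by apply/row_fullP; exists s.
have eB : B = q *m (s *m B).
  rewrite -{1}[B]mul1mx -e mulmxDl -mulmxA -[w *m t *m B]mulmxA tB.
  by rewrite mulmx0 addr0.
rewrite [in LHS]eB !(mulmxA (pinvmx q)) mulVpmx // mul1mx.
by rewrite -eB.
Qed.

Lemma cokernel_epi a b c d (t : 'M[K]_(a, b)) (q : 'M[K]_(b, c))
    (A B : 'M[K]_(c, d)) :
  is_cokernel t q -> q *m A = q *m B -> A = B.
Proof.
case=> _ [s [w [sq e]]] /(congr1 (mulmx s)).
by rewrite !mulmxA sq !mul1mx.
Qed.

Lemma cokernel_ker a b c d (t : 'M[K]_(a, b)) (q : 'M[K]_(b, c))
    (v : 'M[K]_(d, b)) :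
  is_cokernel t q -> v *m q = 0 -> (v <= t)%MS.
Proof.
case=> _ [s [w [_ e]]] vq; apply/submxP; exists (v *m w).
by rewrite -[LHS]mulmx1 -e mulmxDr mulmxA vq mul0mx add0r mulmxA.
Qed.

Lemma cokernelI a b c (t : 'M[K]_(a, b)) (q : 'M[K]_(b, c)) (s : 'M[K]_(c, b)) :
  t *m q = 0 -> s *m q = 1%:M ->
  (forall v : 'M[K]_b, v *m q = 0 -> (v <= t)%MS) -> is_cokernel t q.
Proof.
move=> tq sq h; split=> //.
have /submxP[w ew] : (1%:M - q *m s <= t)%MS.
  by apply: h; rewrite mulmxBl -mulmxA sq mulmx1 mul1mx subrr.
by exists s, w; rewrite -ew addrC subrK.
Qed.

Lemma cokernel_tens a b c n (t : 'M[K]_(a, b)) (q : 'M[K]_(b, c)) :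
  is_cokernel t q -> is_cokernel (1%:M *t t : 'M_(n * a, n * b)) (1%:M *t q).
Proof.
case=> tq [s [w [sq e]]]; split; first by rewrite tensmx_mul tq tensmx0.
exists (1%:M *t s), (1%:M *t w); rewrite !tensmx_mul sq !mulmx1 tensmx11.
split=> //; rewrite -tensmx11 -e; apply/matrixP=> i j; rewrite !mxE.
by rewrite -mulrDr.
Qed.

Lemma cokernel_cokproj n (T : 'M[K]_n) : is_cokernel T (cokproj T).
Proof.
apply: (@cokernelI _ _ _ _ _ (pinvmx (cokproj T))); first exact: mul_cokproj.
  by rewrite mulVpmx // col_base_full.
by move=> v vQ; rewrite submxE -(mulmx_base (cokermx T)) mulmxA vQ mul0mx.
Qed.

Lemma cokmapE n p (T : 'M[K]_n) (T' : 'M[K]_p) (A : 'M[K]_(n, p)) B :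
  T *m A = B *m T' -> cokproj T *m cokmap T T' A = A *m cokproj T'.
Proof.
move=> e; rewrite /cokmap -mulmxA cokprojK //.
by rewrite mulmxA e -mulmxA mul_cokproj mulmx0.
Qed.

End Cokernels.

(** * Conjugating intertwining matrices *)

Section Intertwiners.
Variable K : fieldType.

Lemma intertwine_inv a b (A : 'M[K]_(a, b)) (B : 'M_(b, a)) (L : 'M_a)
    (M : 'M_b) :
  A *m B = 1%:M -> B *m A = 1%:M -> L *m A = A *m M -> M *m B = B *m L.
Proof.
move=> AB BA LA; rewrite -[LHS]mul1mx -BA !mulmxA -(mulmxA B A) -LA.
by rewrite -!mulmxA AB mulmx1.
Qed.

Lemma intertwine_comp a b c d (R : 'M[K]_a) (O : 'M_(a, b)) (S : 'M_b)
    (A : 'M_(b, c)) (r : 'M_c) (I : 'M_(c, d)) (R' : 'M_d) :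
  R *m O = O *m S -> S *m A = A *m r -> r *m I = I *m R' ->
  R *m (O *m A *m I) = O *m A *m I *m R'.
Proof. by move=> eO eA eI; rewrite !mulmxA eO -(mulmxA O) eA -!mulmxA eI. Qed.

Lemma conj_idem a b (A : 'M[K]_(a, b)) (B : 'M_(b, a)) (P : 'M_b) :
  B *m A = 1%:M -> P *m P = P -> A *m P *m B *m (A *m P *m B) = A *m P *m B.
Proof.
by move=> BA PP; rewrite !mulmxA -(mulmxA _ B A) BA mulmx1 -(mulmxA A P P) PP.
Qed.

Lemma conj_eq0 a b (A : 'M[K]_(a, b)) (B : 'M_(b, a)) (P : 'M_b) :
  B *m A = 1%:M -> A *m P *m B = 0 -> P = 0.
Proof.
move=> BA e; rewrite -[P]mul1mx -[LHS]mulmx1 -BA -!mulmxA (mulmxA P) (mulmxA A).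
by rewrite [A *m _]mulmxA e mul0mx mulmx0.
Qed.

Lemma conj_eq1 a b (A : 'M[K]_(a, b)) (B : 'M_(b, a)) (P : 'M_b) :
  B *m A = 1%:M -> A *m P *m B = 1%:M -> P = 1%:M.
Proof.
move=> BA e; rewrite -[P]mul1mx -[LHS]mulmx1 -BA -!mulmxA (mulmxA P) (mulmxA A).
by rewrite [A *m _]mulmxA e mul1mx.
Qed.

Lemma mul_square a b b' c c' d (A : 'M[K]_(a, b)) (Q : 'M_(b, c))
    (B : 'M_(c, d)) (C : 'M_(b, b')) (Q' : 'M_(b', d)) (M : 'M_(d, c'))
    (S : 'M_(b', c')) :
  Q *m B = C *m Q' -> Q' *m M = S -> A *m Q *m B *m M = A *m C *m S.
Proof. by move=> eQ <-; rewrite -(mulmxA A) eQ !mulmxA. Qed.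

Lemma conj_id a b c (A : 'M[K]_(a, b)) (B : 'M_(b, a)) (C : 'M_(b, c))
    (M : 'M_(c, a)) :
  B *m A = 1%:M -> A *m C *m M = 1%:M -> C *m M *m A = 1%:M.
Proof.
move=> BA e; rewrite -[LHS]mul1mx -BA -mulmxA (mulmxA A) (mulmxA A) e.
by rewrite mul1mx.
Qed.

End Intertwiners.

(** * Right exact endofunctors *)

Section Linear.
Variable K : fieldType.

Fact dlin_comm (I : finType) (X Y : dmod K) (c : I -> K) (f : I -> dhom X Y)
    (cf := \sum_i c i *: (f i : 'M_(_, _))) :
  xact X *m cf = cf *m xact Y.
Proof.
rewrite mulmx_sumr mulmx_suml; apply: eq_bigr => i _.
by rewrite -scalemxAr -scalemxAl hom_comm.
Qed.
Definition dlin I X Y c f : dhom X Y := DHom (@dlin_comm I X Y c f).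

(** The K-linear functors that preserve cokernels.  Unlike being isomorphic to a
    tensor functor, this property passes visibly to composites and retracts;
    [right_exact_one_mor] identifies the two. *)
Definition right_exact (F : endofunctor K) : Prop :=
  (forall (I : finType) X Y (c : I -> K) (f : I -> dhom X Y),
     fmap F (dlin c f) = dlin c (fun i => fmap F (f i))) /\
  (forall X Y Z (t : dhom X Y) (q : dhom Y Z),
     is_cokernel t q -> is_cokernel (fmap F t) (fmap F q)).

Lemma right_exact_lin F (rF : right_exact F) (I : finType) X Y (c : I -> K)
    (f : I -> dhom X Y) (h : dhom X Y) :
  h = \sum_i c i *: (f i : 'M_(_, _)) :> 'M_(_, _) ->
  fmap F h = \sum_i c i *: (fmap F (f i) : 'M_(_, _)) :> 'M_(_, _).
Proof.
move=> e; have -> : h = dlin c f by apply: dhom_inj.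
by rewrite rF.1.
Qed.

Lemma natE (F G : endofunctor K) (a : nattrans F G) X Y (f : dhom X Y) :
  fmap F f *m a Y = a X *m fmap G f.
Proof. exact: (congr1 (@hom_mx K _ _) (natural a f)). Qed.

Lemma fmapM (F : endofunctor K) X Y Z (f : dhom X Y) (g : dhom Y Z)
    (h : dhom X Z) :
  h = f *m g :> 'M_(_, _) -> fmap F h = fmap F f *m fmap F g :> 'M_(_, _).
Proof.
by move=> e; have -> : h = dcomp g f by [apply: dhom_inj]; rewrite fmap_comp.
Qed.

Lemma fmap1 (F : endofunctor K) X (h : dhom X X) :
  h = 1%:M :> 'M_(_, _) -> fmap F h = 1%:M :> 'M_(_, _).
Proof.
by move=> e; have -> : h = did X by [apply: dhom_inj]; rewrite fmap_id.
Qed.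

Lemma right_exact_id : right_exact fid.
Proof. by []. Qed.

Lemma right_exact_comp F G :
  right_exact F -> right_exact G -> right_exact (fcomp F G).
Proof.
case=> lF eF [lG eG]; split=> [I X Y c f|X Y Z t q h] /=; last by apply/eF/eG.
by rewrite lG lF.
Qed.

(** The value of [F] on a morphism is that of [G] framed by [i] and [r], so a
    section and a lift for [G] give ones for [F] by the same framing. *)
Lemma right_exact_retract F G (i : nattrans F G) (r : nattrans G F) :
  (forall X, i X *m r X = 1%:M) -> right_exact G -> right_exact F.
Proof.
move=> ir [lG eG].
have fF X Y (f : dhom X Y) : fmap F f = i X *m fmap G f *m r Y :> 'M_(_, _).
  by rewrite -natE -mulmxA ir mulmx1.
split=> [I X Y c f|X Y Z t q /[dup] ex /eG [tq [s [w [sq e]]]]].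
  apply: dhom_inj; rewrite fF lG /= mulmx_sumr mulmx_suml.
  by apply: eq_bigr => j _; rewrite fF -scalemxAr -scalemxAl.
have iq := natE i q; have it := natE i t.
have rq := natE r q; have rt := natE r t.
split.
  rewrite -[LHS]mulmx1 -(ir Z) mulmxA -(mulmxA _ _ (i Z)) iq.
  by rewrite !mulmxA it -(mulmxA (i X)) tq mulmx0 mul0mx.
exists (i Z *m s *m r Y), (i Y *m w *m r X); split.
  by rewrite -mulmxA -rq mulmxA -(mulmxA (i Z)) sq mulmx1 ir.
rewrite -[_ *m fmap F t]mulmxA -rt !mulmxA iq -!(mulmxA (i Y)).
by rewrite -mulmxDr -mulmxDl e mul1mx ir.
Qed.

Lemma tens_homE (U : bimod K) X Y (f : dhom X Y) :
  cokproj (trel U X) *m tens_hom U f = (1%:M *t f) *m cokproj (trel U Y).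
Proof. exact: cokmapE (trel_hom U f). Qed.

(** The usual diagram chase: an element of the kernel of U (x)_D q lifts to
    U (x)_K Y, where after correction by a relation it is killed by U (x)_K q,
    hence comes from U (x)_K X. *)
Lemma right_exact_tens (U : bimod K) : right_exact (tens U).
Proof.
split=> [I X Y c f|X Y Z t q /[dup] ex [tq [s [w [sq e]]]]].
  apply: dhom_inj => /=; apply: (cokernel_epi (cokernel_cokproj (trel U X))).
  rewrite mulmx_sumr (cokmapE (trel_hom U (dlin c f))) /=.
  have -> : 1%:M *t (\sum_i c i *: (f i : 'M_(_, _))) =
    \sum_i c i *: (1%:M *t f i) :> 'M_(bdim U * dim X, bdim U * dim Y).
    apply/matrixP=> r l; rewrite !(mxE, summxE) mulr_sumr.
    by apply: eq_bigr => j _; rewrite !mxE mulrCA.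
  rewrite mulmx_suml; apply: eq_bigr => j _.
  by rewrite -scalemxAl -scalemxAr (cokmapE (trel_hom U (f j))).
have ex1 := cokernel_tens (bdim U) ex.
have et := tens_homE U t; have eq := tens_homE U q.
have exX := cokernel_cokproj (trel U X).
have exY := cokernel_cokproj (trel U Y).
have exZ := cokernel_cokproj (trel U Z).
have [TY [PY [_ [PQ _]]]] := exY.
apply: (@cokernelI _ _ _ _ _ _ (pinvmx (cokproj (trel U Z)) *m (1%:M *t s) *m
  cokproj (trel U Y))).
- apply: (cokernel_epi exX); rewrite mulmxA et -mulmxA eq mulmxA tensmx_mul tq.
  by rewrite tensmx0 mul0mx mulmx0.
- rewrite -mulmxA eq mulmxA -[_ *m _ *m (1%:M *t q)]mulmxA tensmx_mul sq mulmx1.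
  by rewrite tensmx11 mulmx1 mulVpmx // col_base_full.
move=> v vq; have /(cokernel_ker exZ)/submxP[c ec] :
    v *m PY *m (1%:M *t q) *m cokproj (trel U Z) = 0.
  by rewrite -mulmxA -eq mulmxA -(mulmxA v) PQ mulmx1.
have /(cokernel_ker ex1)/submxP[d ed] :
    (v *m PY - c *m (1%:M *t s) *m trel U Y) *m (1%:M *t q) = 0.
  rewrite mulmxBl ec -!mulmxA trel_hom !mulmxA -(mulmxA c) tensmx_mul sq mulmx1.
  by rewrite tensmx11 mulmx1 subrr.
apply/submxP; exists (d *m cokproj (trel U X)); rewrite -mulmxA et mulmxA -ed.
by rewrite mulmxBl -!mulmxA TY !mulmx0 subr0 PQ mulmx1.
Qed.
End Linear.

(** * The presentation of F(X) by F(D) *)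

Section EW.
Variable K : fieldType.
Local Notation e0 := (delta_mx 0 0 : 'rV[K]_2).
Local Notation e1 := (delta_mx 0 1 : 'rV[K]_2).

Fact regD_sq : (delta_mx 0 1 : 'M[K]_2) *m (delta_mx 0 1 : 'M_2) = 0.
Proof. by rewrite mul_delta_mx_0. Qed.
(** D as a left module, with 1 and x as first and second basis vectors; [rho] is
    right multiplication by x, which has the same matrix as left multiplication
    because D is commutative. *)
Definition regD : dmod K := DMod regD_sq.
Definition rho : dhom regD regD := @DHom K regD regD (delta_mx 0 1) erefl.

Lemma e0x : e0 *m xact regD = e1.
Proof. by rewrite mul_delta_mx. Qed.

Lemma mx2_ext n (A B : 'M[K]_(2, n)) :
  e0 *m A = e0 *m B -> e1 *m A = e1 *m B -> A = B.
Proof.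
rewrite -!rowE => h0 h1; apply/row_matrixP=> i.
case: (unliftP 0 i) => [j|] -> //.
by rewrite [j]ord1 (_ : lift 0 0 = 1) //; apply: val_inj.
Qed.

Lemma regD_ext X (f g : dhom regD X) : e0 *m f = e0 *m g -> f = g.
Proof.
move=> h; apply: dhom_inj; apply: mx2_ext => //.
rewrite -e0x -!mulmxA.
by rewrite (hom_comm f) (hom_comm g) !mulmxA h.
Qed.

Fact gen_comm (X : dmod K) (v : 'rV_(dim X)) (g : 'M[K]_(2, dim X) :=
    delta_mx 0 (0 : 'I_1) *m v + delta_mx 1 (0 : 'I_1) *m (v *m xact X)) :
  xact regD *m g = g *m xact X.
Proof.
rewrite /= mulmxDr mulmxDl !mulmxA !mul_delta_mx_cond /= !mul0mx add0r.
by rewrite -!mulmxA xact_sq !mulmx0 addr0.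
Qed.
(** The morphism D -> X with 1 |-> v. *)
Definition gen (X : dmod K) (v : 'rV_(dim X)) : dhom regD X :=
  DHom (gen_comm v).

Lemma e0_gen X (v : 'rV_(dim X)) : e0 *m gen v = v.
Proof.
rewrite /= mulmxDr !mulmxA !mul_delta_mx_cond /= !mul0mx addr0.
rewrite mulr1n (_ : delta_mx 0 0 = 1%:M) ?mul1mx //.
by apply/matrixP=> i j; rewrite !ord1 !mxE.
Qed.

Lemma gen_comp X Y (v : 'rV_(dim X)) (g : dhom X Y) :
  dcomp g (gen v) = gen (v *m g).
Proof.
by apply: regD_ext; rewrite e0_gen /dcomp /= mulmxA -/(hom_mx (gen v)) e0_gen.
Qed.

Fact free_sq n : (xact regD *t (1%:M : 'M_n)) *m (xact regD *t 1%:M) = 0.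
Proof. by rewrite tensmx_mul xact_sq tens0mx. Qed.
Definition free n : dmod K := DMod (free_sq n).
Fact finj_comm n (i : 'I_n) :
  xact regD *m tinj K 2 i = tinj K 2 i *m xact (free n).
Proof. by rewrite tinj_tensl. Qed.
Definition finj n (i : 'I_n) : dhom regD (free n) :=
  @DHom K regD (free n) _ (finj_comm i).
Fact fprj_comm n (i : 'I_n) :
  xact (free n) *m tprj K 2 i = tprj K 2 i *m xact regD.
Proof.
apply: tinj_ext => j; rewrite !mulmxA tinj_tensl tinj_prj -mulmxA tinj_prj.
by rewrite mul_mx_scalar mul_scalar_mx.
Qed.
Definition fprj n (i : 'I_n) : dhom (free n) regD :=
  @DHom K (free n) regD _ (fprj_comm i).

Section Eps.
Variables (F : endofunctor K) (X : dmod K).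

(** [eps F X] is the map w (x) v |-> F(1 |-> v)(w) from F(D) (x)_K X to F(X),
    and [eps_rel] spans the relations w x (x) v - w (x) x v, where F(D) is a
    right D-module through [rho]. *)
Definition eps : 'M_(dim (F regD) * dim X, dim (F X)) :=
  stack (fun i => fmap F (gen (delta_mx 0 i))).
Definition eps_rel : 'M_(dim (F regD) * dim X) :=
  fmap F rho *t 1%:M - 1%:M *t xact X.

Fact pres_comm
    (q : 'M_(2 * dim X, dim X) := stack (fun i => gen (delta_mx 0 i))) :
  xact (free (dim X)) *m q = q *m xact X.
Proof.
apply: tinj_ext => i; rewrite mulmxA tinj_tensl -mulmxA tinj_stack.
by rewrite (hom_comm (gen _)) mulmxA tinj_stack.
Qed.
(** [prel] and [pres] are the free presentation
    D (x)_K X -> D (x)_K X -> X of X, with first map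
    d (x) v |-> d x (x) v - d (x) x v. *)
Definition pres : dhom (free (dim X)) X := DHom pres_comm.
Fact prel_comm (t : 'M_(2 * dim X) := rho *t 1%:M - 1%:M *t xact X) :
  xact (free (dim X)) *m t = t *m xact (free (dim X)).
Proof.
by rewrite mulmxBl mulmxBr !tensmx_mul !(mulmx1, mul1mx).
Qed.
Definition prel : dhom (free (dim X)) (free (dim X)) :=
  @DHom K (free _) (free _) _ prel_comm.

Lemma dcomp_pres i : dcomp pres (finj i) = gen (delta_mx 0 i).
Proof. by apply: dhom_inj; rewrite /= tinj_stack. Qed.

Lemma rho_gen v : rho *m @gen X v = gen (v *m xact X) :> 'M_(_, _).
Proof.
rewrite -[LHS]/(hom_mx (dcomp (gen v) rho)).
apply: (congr1 (@hom_mx _ _ _)); apply: regD_ext.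
rewrite e0_gen /= mulmxA mul_delta_mx -e0x -mulmxA (hom_comm (gen v)).
by rewrite mulmxA e0_gen.
Qed.

Lemma gen_sum (v : 'rV_(dim X)) :
  gen v = \sum_j v 0 j *: (gen (delta_mx 0 j) : 'M_(_, _)) :> 'M_(_, _).
Proof.
pose h := dlin (v 0) (fun j => gen (delta_mx 0 j : 'rV_(dim X))).
rewrite -[RHS]/(hom_mx h); apply: (congr1 (@hom_mx _ _ _)); apply: regD_ext.
rewrite e0_gen mulmx_sumr [LHS]row_sum_delta.
by apply: eq_bigr => j _; rewrite -scalemxAr e0_gen.
Qed.

Lemma cokernel_pres : is_cokernel prel pres.
Proof.
split.
  apply: tinj_ext => i; rewrite mulmx0 mulmxA mulmxBr tinj_tensl tinj_tensr.
  rewrite mulmxBl -mulmxA tinj_stack mulmx_suml rho_gen gen_sum -sumrB big1 //.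
  by move=> j _; rewrite -scalemxAl tinj_stack -rowE mxE subrr.
(* the section is v |-> 1 (x) v, the lift x (x) v |-> 1 (x) v, 1 (x) v |-> 0 *)
pose s : 'M_(dim X, 2 * dim X) := \matrix_i (e0 *m tinj K 2 i).
exists s, (delta_mx 1 0 *t 1%:M); split.
  by apply/row_matrixP=> i; rewrite row_mul rowK -mulmxA tinj_stack e0_gen row1.
apply: tinj_ext => i; rewrite mulmx1 mulmxDr !mulmxA tinj_stack tinj_tensl.
rewrite -[_ *m tinj _ _ _ *m _]mulmxA mulmxBr tinj_tensl tinj_tensr.
apply: mx2_ext; rewrite mulmxDr !mulmxA.
  by rewrite e0_gen mul_delta_mx_0 // mul0mx addr0 -rowE rowK.
rewrite mul_delta_mx mulmxBr mulmxA.
have -> : e0 *m rho = e1 by apply: mul_delta_mx.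
have -> : e1 *m gen (delta_mx 0 i) = row i (xact X).
  by rewrite -e0x -mulmxA (hom_comm (gen _)) mulmxA e0_gen rowE.
rewrite mulmx_sum_row mulmx_sumr addrC -addrA [X in _ + X](_ : _ = 0) ?addr0 //.
apply/eqP; rewrite addrC subr_eq0; apply/eqP; apply: eq_bigr => j _.
by rewrite rowK mxE -scalemxAr.
Qed.

End Eps.

(** Apply [F] to the free presentation of X.  Additivity identifies
    F(D (x)_K X) with F(D) (x)_K X through the mutually inverse [P] and [Q], and
    turns the images of [prel] and [pres] into [eps_rel] and [eps]. *)
Lemma cokernel_eps F X : right_exact F -> is_cokernel (eps_rel F X) (eps F X).
Proof.
move=> rF; have [tq [s [w [sq e]]]] := rF.2 _ _ _ _ _ (cokernel_pres X).
pose n := dim X.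
pose P := stack (fun i : 'I_n => fmap F (finj i)).
pose Q := \sum_i fmap F (fprj i) *m tinj K _ (i : 'I_n).
have QP : Q *m P = 1%:M.
  rewrite mulmx_suml -(@fmap1 _ F _ (did (free n))) //.
  rewrite (@right_exact_lin _ _ rF 'I_n _ _ (fun=> 1)
    (fun i => dcomp (finj i) (fprj i))).
    by apply: eq_bigr => i _; rewrite -mulmxA tinj_stack fmap_comp scale1r.
  by rewrite /= -stack_tinj; apply: eq_bigr => i _; rewrite scale1r.
have PQ : P *m Q = 1%:M.
  apply: tinj_ext => i; rewrite mulmxA tinj_stack mulmx1 mulmx_sumr.
  rewrite (bigD1 i) //= mulmxA -(@fmapM _ F _ _ _ _ _ (did regD)) ?fmap_id;
    rewrite ?mul1mx; last first.
    by rewrite /= tinj_prj eqxx.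
  rewrite big1 ?addr0 // => j ij; rewrite mulmxA.
  rewrite -(@fmapM _ F _ _ _ _ _ (dcomp (fprj j) (finj i))) //.
  rewrite (@right_exact_lin _ _ rF void _ _ (fun=> 1) (fun=> did regD)).
    by rewrite big_pred0 ?mul0mx // => - [].
  by rewrite big_pred0 => [|[]] //=; rewrite tinj_prj eq_sym (negPf ij) raddf0.
have eP : eps F X = P *m fmap F (pres X).
  by rewrite stack_mul; apply: eq_stack => i; rewrite -dcomp_pres fmap_comp.
have tP : eps_rel F X *m P = P *m fmap F (prel X).
  apply: tinj_ext => i; rewrite !mulmxA tinj_stack mulmxBr tinj_tensl.
  rewrite tinj_tensr mulmxBl -mulmxA tinj_stack.
  pose r := dlin (xact X i) (@finj n).
  rewrite -[RHS](@fmapM _ F _ _ _ _ _ (dcomp (prel X) (finj i))) //.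
  rewrite (@right_exact_lin _ _ rF bool _ _ (fun b => if b then 1 else -1)
    (fun b => if b then dcomp (finj i) rho else r)).
    rewrite big_bool /= scale1r fmap_comp scaleN1r rF.1 /= mulmx_suml.
    congr (_ - _).
    by apply: eq_bigr => j _; rewrite -scalemxAl tinj_stack.
  by rewrite big_bool /= scale1r scaleN1r mulmxBr tinj_tensl tinj_tensr.
split; first by rewrite eP mulmxA tP -mulmxA tq mulmx0.
exists (s *m Q), (P *m w *m Q); rewrite eP; split.
  by rewrite mulmxA -(mulmxA s) QP mulmx1.
have -> : P *m w *m Q *m eps_rel F X = P *m (w *m fmap F (prel X)) *m Q.
  rewrite -[eps_rel F X]mulmx1 -PQ !mulmxA -[_ *m eps_rel F X *m P]mulmxA tP.
  by rewrite !mulmxA -[_ *m Q *m P]mulmxA QP mulmx1.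
rewrite !mulmxA -[P *m _ *m s]mulmxA -[P *m w *m _]mulmxA -mulmxDl -mulmxDr.
by rewrite e mulmx1.
Qed.

End EW.

(** * Natural transformations determined at D *)

Section Ext.
Variable K : fieldType.
Implicit Types F G H : endofunctor K.
Local Notation regD := (regD K).
Local Notation rho := (rho K).

Lemma eps_nat F X Y (g : dhom X Y) :
  right_exact F -> eps F X *m fmap F g = (1%:M *t g) *m eps F Y.
Proof.
move=> rF; rewrite stack_mul tensr_stack; apply: eq_stack => i.
rewrite -(@fmapM _ F _ _ _ _ _ (dcomp g (gen (delta_mx 0 i)))) // gen_comp.
apply: (@right_exact_lin _ _ rF 'I_(dim Y)); rewrite gen_sum.
by apply: eq_bigr => j _; rewrite -rowE mxE.
Qed.

Lemma eps_xact F X :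
  eps F X *m xact (F X) = (xact (F regD) *t 1%:M) *m eps F X.
Proof.
by rewrite stack_mul tensl_stack; apply: eq_stack => i; rewrite hom_comm.
Qed.

Lemma eps_component F G (a : nattrans F G) X :
  eps F X *m a X = (a regD *t 1%:M) *m eps G X.
Proof.
by rewrite stack_mul tensl_stack; apply: eq_stack => i; rewrite natE.
Qed.

Lemma tinj0_eps F : tinj K _ (0 : 'I_2) *m eps F regD = 1%:M.
Proof.
rewrite (tinj_stack (fun i => fmap F (gen (delta_mx 0 i : 'rV_(dim regD))))).
apply: fmap1; rewrite -[RHS]/(hom_mx (did regD)).
apply: (congr1 (@hom_mx _ _ _)); apply: regD_ext.
by rewrite e0_gen mulmx1.
Qed.

(** [eps] is epic and natural in the functor. *)
Lemma nattrans_regD_inj F G (a b : nattrans F G) :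
  right_exact F -> a regD = b regD :> 'M_(_, _) ->
  forall X, a X = b X :> 'M_(_, _).
Proof.
move=> rF ab X; apply: (cokernel_epi (cokernel_eps X rF)).
by rewrite !eps_component ab.
Qed.

Section Extension.
Variables (F G : endofunctor K) (rF : right_exact F) (rG : right_exact G).
Variables (f : dhom (F regD) (G regD)).
Hypothesis f_rho : fmap F rho *m f = f *m fmap G rho.

(** The only possible extension of [f]: the map induced by f (x)_K X between the
    cokernels [eps F X] and [eps G X].  The relations match because [f] commutes
    with right multiplication by x. *)
Definition ext_mx X : 'M_(dim (F X), dim (G X)) :=
  pinvmx (eps F X) *m ((f *t 1%:M) *m eps G X).

Lemma eps_extmx X : eps F X *m ext_mx X = (f *t 1%:M) *m eps G X.
Proof.
apply: (cokernel_factor (cokernel_eps X rF)).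
have [rel _] := cokernel_eps X rG.
suff e : eps_rel F X *m (f *t 1%:M) = (f *t 1%:M) *m eps_rel G X.
  by rewrite mulmxA e -mulmxA rel mulmx0.
by rewrite mulmxBl mulmxBr !tensmx_mul !(mulmx1, mul1mx) f_rho.
Qed.

Fact ext_comm X : xact (F X) *m ext_mx X = ext_mx X *m xact (G X).
Proof.
apply: (cokernel_epi (cokernel_eps X rF)).
have := eps_extmx X; move: (ext_mx X) => E eE.
rewrite !mulmxA eE (eps_xact F) -[_ *m xact (G X)]mulmxA (eps_xact G).
by rewrite -mulmxA eE !mulmxA !tensmx_mul !mulmx1 hom_comm.
Qed.

Fact ext_natural X Y (g : dhom X Y) :
  dcomp (DHom (ext_comm Y)) (fmap F g) = dcomp (fmap G g) (DHom (ext_comm X)).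
Proof.
apply: dhom_inj; apply: (cokernel_epi (cokernel_eps X rF)); rewrite /=.
have := eps_extmx X; have := eps_extmx Y.
move: (ext_mx X) (ext_mx Y) => EX EY eY eX; rewrite !mulmxA.
rewrite eX (eps_nat g rF) -[_ *m fmap G g]mulmxA (eps_nat g rG).
by rewrite -mulmxA eY !mulmxA !tensmx_mul !(mulmx1, mul1mx).
Qed.
Definition extension : nattrans F G := NatTrans ext_natural.

Lemma extension_regD : extension regD = f.
Proof.
apply: dhom_inj; rewrite -[LHS]/(ext_mx regD).
have := eps_extmx regD; move: (ext_mx regD) => E eE.
rewrite -[LHS]mul1mx -(tinj0_eps F) -mulmxA eE.
by rewrite mulmxA tinj_tensl -mulmxA tinj0_eps mulmx1.
Qed.
End Extension.

Fact nid_natural F X Y (f : dhom X Y) :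
  dcomp (did (F Y)) (fmap F f) = dcomp (fmap F f) (did (F X)).
Proof. by apply: dhom_inj; rewrite /= mulmx1 mul1mx. Qed.
Definition nid F : nattrans F F := NatTrans (@nid_natural F).

Lemma fiso_refl F : fiso F F.
Proof.
by exists (nid F), (nid F) => X; split; apply: dhom_inj; rewrite /= mulmx1.
Qed.

Lemma fiso_retract F G : fiso F G ->
  exists (a : nattrans F G) (b : nattrans G F),
    (forall X, a X *m b X = 1%:M) /\ (forall X, b X *m a X = 1%:M).
Proof.
case=> a [b ab]; exists a, b; split=> X.
  by have /(congr1 (@hom_mx _ _ _)) := (ab X).1.
by have /(congr1 (@hom_mx _ _ _)) := (ab X).2.
Qed.

Lemma fiso_of_regD F G (f : dhom (F regD) (G regD))
    (g : dhom (G regD) (F regD)) :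
  right_exact F -> right_exact G -> fmap F rho *m f = f *m fmap G rho ->
  f *m g = 1%:M -> g *m f = 1%:M -> fiso F G.
Proof.
move=> rF rG fr fg gf.
have gr : fmap G rho *m g = g *m fmap F rho.
  exact: intertwine_inv fg gf fr.
pose a := extension rF rG fr; pose b := extension rG rF gr.
have ea : a regD = f by apply: extension_regD.
have eb : b regD = g by apply: extension_regD.
exists a, b => X; split; apply: dhom_inj.
  by apply: (@nattrans_regD_inj F F (vcomp b a) (nid F)) => //;
    rewrite -[LHS]/(a regD *m b regD) ea eb.
by apply: (@nattrans_regD_inj G G (vcomp a b) (nid G)) => //;
  rewrite -[LHS]/(b regD *m a regD) ea eb.
Qed.

(** * One-morphisms are the right exact functors *)

Section TensReg.
Variable U : bimod K.
Local Notation Q := (cokproj (trel U regD)).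

(** The isomorphism of U with U (x)_D D, u |-> u (x) 1, and its inverse
    u (x) 1 |-> u, u (x) x |-> u x. *)
Definition tens_in : 'M_(bdim U, dim (tens U regD)) := tinj K _ (0 : 'I_2) *m Q.
Definition tens_out : 'M_(dim (tens U regD), bdim U) :=
  pinvmx Q *m (tprj K _ (0 : 'I_2) + tprj K _ (1 : 'I_2) *m ract U).

Lemma tinj_trel0 :
  tinj K _ (0 : 'I_2) *m trel U regD =
  ract U *m tinj K _ (0 : 'I_2) - tinj K _ (1 : 'I_2).
Proof.
rewrite mulmxBr tinj_tensl tinj_tensr big_ord_recl big_ord1 !mxE /=.
by rewrite scale0r add0r (_ : lift _ _ = 1) ?scale1r //; apply: val_inj.
Qed.

Lemma tinj_trel1 :
  tinj K _ (1 : 'I_2) *m trel U regD = ract U *m tinj K _ (1 : 'I_2).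
Proof.
rewrite mulmxBr tinj_tensl tinj_tensr big_ord_recl big_ord1 !mxE /=.
by rewrite !scale0r addr0 subr0.
Qed.

Lemma tinj1_cokproj : tinj K _ (1 : 'I_2) *m Q = ract U *m tens_in.
Proof.
have := congr1 (mulmx^~ Q) tinj_trel0.
rewrite -mulmxA mul_cokproj mulmx0 mulmxBl -mulmxA => /esym/eqP.
by rewrite subr_eq0 => /eqP.
Qed.

Lemma cokproj_out :
  Q *m tens_out = tprj K _ (0 : 'I_2) + tprj K _ (1 : 'I_2) *m ract U.
Proof.
apply: cokprojK; set M := _ + _.
have M0 : tinj K _ 0 *m M = 1%:M.
  by rewrite mulmxDr mulmxA !tinj_prj /= raddf0 mul0mx addr0.
have M1 : tinj K _ 1 *m M = ract U.
  by rewrite mulmxDr mulmxA !tinj_prj /= raddf0 mul1mx add0r.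
apply: tinj_ext => i; rewrite mulmx0 mulmxA.
have : (i == 0) || (i == 1) by case: i => [[|[]]].
case/orP => /eqP ->; last by rewrite tinj_trel1 -mulmxA M1 ract_sq.
by rewrite tinj_trel0 mulmxBl -mulmxA M0 M1 mulmx1 subrr.
Qed.

Lemma tens_inK : tens_in *m tens_out = 1%:M.
Proof.
rewrite -mulmxA cokproj_out mulmxDr mulmxA !tinj_prj /=.
by rewrite raddf0 mul0mx addr0.
Qed.

Lemma tens_outK : tens_out *m tens_in = 1%:M.
Proof.
apply: (cokernel_epi (cokernel_cokproj _)); rewrite mulmxA cokproj_out mulmx1.
have e : tprj K (bdim U) (0 : 'I_2) *m tinj K (bdim U) (0 : 'I_2) +
    tprj K (bdim U) (1 : 'I_2) *m tinj K (bdim U) (1 : 'I_2) = 1%:M.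
  rewrite -[RHS]stack_tinj /stack big_ord_recl big_ord1.
  by rewrite (_ : lift _ _ = 1) //; apply: val_inj.
rewrite mulmxDl -[X in _ + X]mulmxA -tinj1_cokproj.
by rewrite [X in X + _]mulmxA [X in _ + X]mulmxA -mulmxDl e mul1mx.
Qed.

Fact tens_in_lact : lact U *m tens_in = tens_in *m xact (tens U regD).
Proof.
rewrite -(mulmxA (tinj _ _ _)) (cokmapE (trel_lact U regD)) !mulmxA.
by rewrite tinj_tensl.
Qed.

Lemma tens_in_ract : ract U *m tens_in = tens_in *m fmap (tens U) rho.
Proof.
rewrite -[RHS]mulmxA [X in _ = _ *m X](tens_homE U rho).
rewrite [RHS]mulmxA [X in _ = X *m _](tinj_tensr _ (0 : 'I_2) rho).
rewrite big_ord_recl big_ord1 !mxE /= scale0r add0r scale1r -tinj1_cokproj.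
by congr (tinj _ _ _ *m _); apply: val_inj.
Qed.

Fact tens_out_lact : xact (tens U regD) *m tens_out = tens_out *m lact U.
Proof.
exact: intertwine_inv tens_inK tens_outK tens_in_lact.
Qed.

Lemma tens_out_ract : fmap (tens U) rho *m tens_out = tens_out *m ract U.
Proof.
exact: intertwine_inv tens_inK tens_outK tens_in_ract.
Qed.

End TensReg.

Section EilenbergWatts.
Variables (F : endofunctor K) (rF : right_exact F).

Fact reg_ract_sq : fmap F rho *m fmap F rho = 0.
Proof.
have e : dcomp rho rho = dlin (fun _ : void => 0) (fun=> rho).
  apply: dhom_inj; rewrite /= big_pred0 => [|[]].
  by rewrite mul_delta_mx_0.
rewrite -(@fmapM _ F _ _ _ _ _ (dcomp rho rho)) // e rF.1 /=.
by rewrite big_pred0 => [|[]].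
Qed.
(** F(D) as a bimodule: the right action is the functorial image of the right
    action of D on itself. *)
Definition reg_bimod : bimod K :=
  Bimod (xact_sq (F regD)) reg_ract_sq (hom_comm (fmap F rho)).

(** Eilenberg-Watts: [F] and tensoring with F(D) agree at D, hence
    everywhere. *)
Lemma right_exact_one_mor : one_mor F.
Proof.
exists reg_bimod; pose U := reg_bimod.
pose f := @DHom K (F regD) (tens U regD) _ (tens_in_lact U).
pose g := @DHom K (tens U regD) (F regD) _ (tens_out_lact U).
apply: (@fiso_of_regD _ _ f g) => //; first exact: right_exact_tens.
- exact: (tens_in_ract U).
- exact: (tens_inK U).
- exact: (tens_outK U).
Qed.
End EilenbergWatts.

(** * Retracts are summands *)

Section Splitting.
Variables (G : endofunctor K) (e : nattrans G G).
(* a rank factorization of e: the image of e at X is K^(d X) *)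
Variables (d : dmod K -> nat) (b : forall X, 'M[K]_(d X, dim (G X))).
Variable c : forall X, 'M[K]_(dim (G X), d X).
Hypothesis split_cb : forall X, c X *m b X = e X.
Hypothesis split_bc : forall X, b X *m c X = 1%:M.

Lemma split_be X : b X *m e X = b X.
Proof. by rewrite -[RHS]mul1mx -(split_bc X) -mulmxA split_cb. Qed.
Lemma split_ec X : e X *m c X = c X.
Proof. by rewrite -[RHS]mulmx1 -(split_bc X) mulmxA split_cb. Qed.

Fact split_sq X (x := b X *m xact (G X) *m c X) : x *m x = 0.
Proof.
rewrite /x !mulmxA -(mulmxA _ (c X)) split_cb -(mulmxA (b X)) hom_comm.
by rewrite mulmxA split_be -(mulmxA (b X)) xact_sq mulmx0 mul0mx.
Qed.
Definition split_obj X : dmod K := DMod (split_sq X).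

Fact split_hom_comm X Y (f : dhom X Y) (g := b X *m fmap G f *m c Y) :
  xact (split_obj X) *m g = g *m xact (split_obj Y).
Proof.
rewrite /g /= !mulmxA -(mulmxA _ (c X)) split_cb -(mulmxA _ (c Y)) split_cb.
rewrite -(mulmxA (b X) _ (e X)) hom_comm mulmxA split_be -(mulmxA (b X)).
by rewrite hom_comm -(mulmxA (b X) _ (e Y)) natE !mulmxA split_be.
Qed.
Definition split_hom X Y (f : dhom X Y) : dhom (split_obj X) (split_obj Y) :=
  @DHom K (split_obj X) (split_obj Y) _ (split_hom_comm f).

Fact split_fid X : split_hom (did X) = did (split_obj X).
Proof. by apply: dhom_inj; rewrite /= fmap_id mulmx1 split_bc. Qed.
Fact split_fcomp X Y Z (g : dhom Y Z) (f : dhom X Y) :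
  split_hom (dcomp g f) = dcomp (split_hom g) (split_hom f).
Proof.
apply: dhom_inj; rewrite /= fmap_comp /= !mulmxA -(mulmxA _ (c Y)) split_cb.
by rewrite -(mulmxA (b X) _ (e Y)) natE mulmxA split_be.
Qed.
Definition split_fun : endofunctor K := Endofunctor split_fid split_fcomp.

Fact split_in_comm X : xact (split_obj X) *m b X = b X *m xact (G X).
Proof. by rewrite /= -mulmxA split_cb -mulmxA hom_comm mulmxA split_be. Qed.
Fact split_in_natural X Y (f : dhom X Y) :
  dcomp (@DHom K (split_fun Y) (G Y) _ (split_in_comm Y)) (fmap split_fun f) =
  dcomp (fmap G f) (@DHom K (split_fun X) (G X) _ (split_in_comm X)).
Proof.
by apply: dhom_inj; rewrite /= -mulmxA split_cb -mulmxA natE mulmxA split_be.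
Qed.
Definition split_in : nattrans split_fun G := NatTrans split_in_natural.

Fact split_out_comm X : xact (G X) *m c X = c X *m xact (split_obj X).
Proof. by rewrite /= !mulmxA split_cb -hom_comm -mulmxA split_ec. Qed.
Fact split_out_natural X Y (f : dhom X Y) :
  dcomp (@DHom K (G Y) (split_fun Y) _ (split_out_comm Y)) (fmap G f) =
  dcomp (fmap split_fun f) (@DHom K (G X) (split_fun X) _ (split_out_comm X)).
Proof.
by apply: dhom_inj; rewrite /= !mulmxA split_cb -natE -mulmxA split_ec.
Qed.
Definition split_out : nattrans G split_fun := NatTrans split_out_natural.
End Splitting.

Lemma idem_bases n (e : 'M[K]_n) :
  e *m e = e -> row_base e *m col_base e = 1%:M.
Proof.
move=> ee; apply: (row_free_inj (row_base_free e)).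
apply: (row_full_inj (col_base_full e)).
by rewrite mul1mx -(mulmxA (row_base e)) !mulmx_base mulmxA mulmx_base.
Qed.

Lemma idem_split G (e : nattrans G G) : (forall X, e X *m e X = e X) ->
  exists (F : endofunctor K) (b : nattrans F G) (c : nattrans G F),
    (forall X, b X *m c X = 1%:M) /\ (forall X, c X *m b X = e X).
Proof.
move=> ee; pose cb X := mulmx_base (e X); pose bc X := idem_bases (ee X).
by exists (split_fun cb bc), (split_in cb bc), (split_out cb bc).
Qed.

Section CompRetract.
Variables (F G : endofunctor K) (i : nattrans F G) (r : nattrans G F).

Fact complement_comm X (e := 1%:M - r X *m i X) :
  xact (G X) *m e = e *m xact (G X).
Proof.
by rewrite mulmxBr mulmxBl mulmx1 mul1mx mulmxA hom_comm -!mulmxA hom_comm.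
Qed.
Fact complement_natural X Y (f : dhom X Y) :
  dcomp (@DHom K (G Y) (G Y) _ (complement_comm Y)) (fmap G f) =
  dcomp (fmap G f) (@DHom K (G X) (G X) _ (complement_comm X)).
Proof.
apply: dhom_inj; rewrite /= mulmxBr mulmxBl mulmx1 mul1mx mulmxA.
by rewrite natE -!mulmxA natE.
Qed.
Definition complement : nattrans G G := NatTrans complement_natural.
End CompRetract.

Section Biproduct.
Variables A B G : endofunctor K.

Fact pair_comm (a : nattrans G A) (b : nattrans G B) X
    (ab : 'M_(dim (G X), dim (fplus A B X)) := row_mx (a X) (b X)) :
  xact (G X) *m ab = ab *m xact (fplus A B X).
Proof.
by rewrite /ab mul_mx_row mul_row_block !mulmx0 addr0 add0r !hom_comm.
Qed.
Fact pair_natural (a : nattrans G A) (b : nattrans G B) X Y (f : dhom X Y) :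
  dcomp (@DHom K (G Y) (fplus A B Y) _ (pair_comm a b Y)) (fmap G f) =
  dcomp (fmap (fplus A B) f) (@DHom K (G X) (fplus A B X) _ (pair_comm a b X)).
Proof.
apply: dhom_inj; rewrite /= mul_mx_row mul_row_block !mulmx0 addr0 add0r.
by rewrite !natE.
Qed.
Definition npair a b : nattrans G (fplus A B) := NatTrans (pair_natural a b).

Fact copair_comm (a : nattrans A G) (b : nattrans B G) X
    (ab : 'M_(dim (fplus A B X), dim (G X)) := col_mx (a X) (b X)) :
  xact (fplus A B X) *m ab = ab *m xact (G X).
Proof.
by rewrite /ab mul_block_col mul_col_mx !mul0mx addr0 add0r !hom_comm.
Qed.
Fact copair_natural (a : nattrans A G) (b : nattrans B G) X Y (f : dhom X Y) :
  dcomp (@DHom K (fplus A B Y) (G Y) _ (copair_comm a b Y))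
    (fmap (fplus A B) f) =
  dcomp (fmap G f) (@DHom K (fplus A B X) (G X) _ (copair_comm a b X)).
Proof.
apply: dhom_inj; rewrite /= mul_block_col mul_col_mx !mul0mx addr0 add0r.
by rewrite !natE.
Qed.
Definition ncopair a b : nattrans (fplus A B) G :=
  NatTrans (copair_natural a b).
End Biproduct.

(** The complement is the image of the idempotent 1 - r i; it is again a
    1-morphism because right exactness passes to retracts. *)
Lemma summand_retract F G (i : nattrans F G) (r : nattrans G F) :
  right_exact G -> (forall X, i X *m r X = 1%:M) -> summand F G.
Proof.
move=> rG ir; pose e := complement i r.
have ie X : i X *m e X = 0 by rewrite mulmxBr mulmx1 mulmxA ir mul1mx subrr.
have er X : e X *m r X = 0 by rewrite mulmxBl mul1mx -mulmxA ir mulmx1 subrr.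
have ee X : e X *m e X = e X.
  rewrite -[LHS]/((1%:M - r X *m i X) *m e X) mulmxBl mul1mx -mulmxA ie.
  by rewrite mulmx0 subr0.
have [F' [b [c [bc cb]]]] := idem_split ee.
exists F'; split; first exact: right_exact_one_mor (right_exact_retract bc rG).
exists (npair r c), (ncopair i b) => X; split; apply: dhom_inj => /=.
  by rewrite mul_row_col cb addrC subrK.
have ic : i X *m c X = 0.
  by rewrite -[LHS]mulmx1 -(bc X) mulmxA -(mulmxA (i X)) cb ie mul0mx.
have br : b X *m r X = 0.
  by rewrite -[LHS]mul1mx -(bc X) -!mulmxA [c X *m _]mulmxA cb er mulmx0.
by rewrite mul_col_row ir ic br bc -scalar_mx_block.
Qed.

End Ext.

(** * Computations in string bimodules *)

Section Strings.
Variable K : fieldType.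

(** Every row and column of a string matrix has at most one nonzero entry, so
    each sum below has a single candidate index [c], possibly out of range. *)
Lemma sum_pick n c (f : pred nat) (g : nat -> K) :
  (forall p, (p < n)%N -> f p -> p = c) ->
  \sum_(p < n) (f p)%:R * g p = ((c < n)%N && f c)%:R * g c.
Proof.
move=> fc; case: (ltnP c n) => [ltcn|lenc].
  rewrite (bigD1 (Ordinal ltcn)) //= big1 ?addr0 // => p hp.
  case: (boolP (f p)) => [/(fc _ (ltn_ord p)) e|]; last by rewrite mul0r.
  by case/eqP: hp; apply: val_inj.
rewrite mul0r big1 // => p _.
case: (boolP (f p)) => [/(fc _ (ltn_ord p)) e|]; last by rewrite mul0r.
by move: (ltn_ord p); rewrite e ltnNge lenc.
Qed.

Lemma sum_pickb n c (f g : pred nat) :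
  (forall p, (p < n)%N -> f p -> p = c) ->
  \sum_(p < n) (f p)%:R * (g p)%:R = [&& (c < n)%N, f c & g c]%:R :> K.
Proof.
move=> fc; rewrite (@sum_pick n c f (fun p => (g p)%:R)) //.
by rewrite -natrM mulnb andbA.
Qed.

(** How W_m acts on V, the string bimodule with n basis vectors starting at m_2,
    under the pairing V (x)_D W_m -> V; index i stands for m_(2+i).  An even
    basis vector m_(2+j) acts as the projection of V onto the left submodule
    spanned by m_(2+j) and x m_(2+j); these submodules decompose V.  The odd
    basis vector m_(2+j+1) = x m_(2+j) must then act by v |-> (v x) m_(2+j),
    which maps m_(2+j+2) to m_(2+j+1) and kills the other basis vectors. *)
Definition act_coef (j i l : nat) : bool :=
  if odd j then (i == j.+1) && (l == j) else (i == l) && (i./2 == j./2).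
Definition act_mx n (j : nat) : 'M[K]_n := \matrix_(i, l) (act_coef j i l)%:R.

(** In W_m, the sum m_2 + m_4 + ... + m_(2m+2); both left and right
    multiplication by x turn it into m_3 + m_5 + ... + m_(2m+1). *)
Definition diag_vec n : 'rV[K]_n := \row_j (~~ odd j)%:R.

Section Act.
Variable m : nat.
Let w := (2 * m + 1)%N.

Lemma diag_vec_central :
  diag_vec w *m string_lact K 2 w = diag_vec w *m string_ract K 2 w.
Proof.
apply/rowP=> l; rewrite !mxE.
under eq_bigr do rewrite !mxE mulrC.
rewrite (@sum_pickb w l.-1 (fun p => ~~ odd (2 + p) && (l == p.+1 :> nat))
  (fun p => ~~ odd p)); last by move=> p; lia.
under eq_bigr do rewrite !mxE mulrC.
rewrite (@sum_pickb w l.+1 (fun p => ~~ odd (2 + p) && (p == l.+1 :> nat))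
  (fun p => ~~ odd p)); last by move=> p; lia.
by congr (nat_of_bool _)%:R; have := ltn_ord l; rewrite /w; lia.
Qed.

(* W_m must have an even basis vector for every even basis vector of V, or the
   projections would not add up to the identity *)
Variable n : nat.
Hypothesis le_nm : (n <= 2 * m + 2)%N.

Lemma act_ract (j : 'I_w) : string_ract K 2 n *m act_mx n j =
  \sum_(l < w) string_lact K 2 w j l *: act_mx n l.
Proof.
apply/matrixP=> i l; rewrite mxE summxE.
under eq_bigr do rewrite !mxE.
under [RHS]eq_bigr do rewrite !mxE.
rewrite (@sum_pickb n i.-1 (fun p => ~~ odd (2 + i) && (i == p.+1 :> nat))
  (fun p => act_coef j p l)); last by move=> p; lia.
rewrite (@sum_pickb w j.+1 (fun p => ~~ odd (2 + j) && (p == j.+1 :> nat))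
  (fun p => act_coef p i l)); last by move=> p; lia.
congr (nat_of_bool _)%:R.
have := ltn_ord l; have := ltn_ord i; have := ltn_ord j.
rewrite /act_coef /w; case: ifP; case: ifP; lia.
Qed.

Lemma act_lact (j : 'I_w) :
  string_lact K 2 n *m act_mx n j = act_mx n j *m string_lact K 2 n.
Proof.
apply/matrixP=> i l; rewrite !mxE.
under eq_bigr do rewrite !mxE.
under [RHS]eq_bigr do rewrite !mxE mulrC.
rewrite (@sum_pickb n i.+1 (fun p => ~~ odd (2 + i) && (p == i.+1 :> nat))
  (fun p => act_coef j p l)); last by move=> p; lia.
rewrite (@sum_pickb n l.-1 (fun p => ~~ odd (2 + p) && (l == p.+1 :> nat))
  (fun p => act_coef j i p)); last by move=> p; lia.
congr (nat_of_bool _)%:R.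
have := ltn_ord l; have := ltn_ord i; have := ltn_ord j.
rewrite /act_coef /w; case: ifP; lia.
Qed.

Lemma act_ract_right (j : 'I_w) :
  \sum_(l < w) string_ract K 2 w j l *: act_mx n l =
  act_mx n j *m string_ract K 2 n.
Proof.
apply/matrixP=> i l; rewrite [RHS]mxE summxE.
under eq_bigr do rewrite !mxE.
under [RHS]eq_bigr do rewrite !mxE mulrC.
rewrite (@sum_pickb w j.-1 (fun p => ~~ odd (2 + j) && (j == p.+1 :> nat))
  (fun p => act_coef p i l)); last by move=> p; lia.
rewrite (@sum_pickb n l.+1 (fun p => ~~ odd (2 + p) && (p == l.+1 :> nat))
  (fun p => act_coef j i p)); last by move=> p; lia.
congr (nat_of_bool _)%:R.
have := ltn_ord l; have := ltn_ord i; have := ltn_ord j.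
rewrite /act_coef /w; case: ifP; case: ifP; lia.
Qed.

Lemma act_diag_vec : \sum_(j < w) diag_vec w 0 j *: act_mx n j = 1%:M.
Proof.
apply/matrixP=> i l; rewrite summxE mxE.
under eq_bigr do rewrite !mxE -natrM mulnb -[_%:R]mulr1.
rewrite (@sum_pickb w (i./2).*2 (fun j => ~~ odd j && act_coef j i l) xpredT).
  congr (nat_of_bool _)%:R; have := ltn_ord l; have := ltn_ord i.
  rewrite /act_coef /w -val_eqE /=; case: ifP; lia.
by move=> p; rewrite /act_coef; case: ifP; lia.
Qed.
End Act.

(** The idempotents of the endomorphism ring of W_k are trivial.  On the even
    basis vectors, modulo the odd ones, E is a square matrix c(p,q).  Commuting
    with x on both sides makes this block Toeplitz, with zeros in row 0 to the
    right of the diagonal and in row k to its left, hence a scalar; the block on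
    the odd vectors is the same scalar.  So E = c + N, where N maps even to odd
    basis vectors and N^2 = 0; then E^2 = E forces c = 0 or c = 1, and N = 0. *)
Lemma W_idempotent n k (E : 'M[K]_n) : n = (2 * k).+1 ->
  string_lact K 2 n *m E = E *m string_lact K 2 n ->
  string_ract K 2 n *m E = E *m string_ract K 2 n ->
  E *m E = E -> E = 0 \/ E = 1%:M.
Proof.
move=> en; subst n; set n := (2 * k).+1 => eL eR EE.
(* entries read at natural numbers, used only for i, j < n *)
pose g (i j : nat) := E (inord i) (inord j).
have gE (i j : 'I_n) : E i j = g i j by rewrite /g !inord_val.
(* the commutation with x on the left and on the right, at entry (i, j) *)
have hL i j : (i < n)%N -> (j < n)%N ->
  ((i.+1 < n)%N && ~~ odd i)%:R * g i.+1 j = (odd j)%:R * g i j.-1.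
  move=> hi hj; have := congr1 (fun M : 'M_n => M (inord i) (inord j)) eL.
  rewrite !mxE.
  under eq_bigr do rewrite !mxE gE !inordK //.
  under [X in _ = X -> _]eq_bigr do rewrite !mxE gE !inordK // mulrC.
  rewrite (@sum_pick n i.+1 (fun p => ~~ odd (2 + i) && (p == i.+1 :> nat))
    (fun p => g p j)); last by move=> p; lia.
  rewrite (@sum_pick n j.-1 (fun p => ~~ odd (2 + p) && (j == p.+1 :> nat))
    (fun p => g i p)); last by move=> p; lia.
  move=> e; apply: etrans (etrans e _); congr (_%:R * _); lia.
have hR i j : (i < n)%N -> (j < n)%N ->
  ((0 < i)%N && ~~ odd i)%:R * g i.-1 j = ((j.+1 < n)%N && odd j)%:R * g i j.+1.
  move=> hi hj; have := congr1 (fun M : 'M_n => M (inord i) (inord j)) eR.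
  rewrite !mxE.
  under eq_bigr do rewrite !mxE gE !inordK //.
  under [X in _ = X -> _]eq_bigr do rewrite !mxE gE !inordK // mulrC.
  rewrite (@sum_pick n i.-1 (fun p => ~~ odd (2 + i) && (i == p.+1 :> nat))
    (fun p => g p j)); last by move=> p; lia.
  rewrite (@sum_pick n j.+1 (fun p => ~~ odd (2 + p) && (p == j.+1 :> nat))
    (fun p => g i p)); last by move=> p; lia.
  move=> e; apply: etrans (etrans e _); congr (_%:R * _); lia.
have useL i j : (i < n)%N -> (j < n)%N -> odd j ->
    g i j.-1 = ((i.+1 < n)%N && ~~ odd i)%:R * g i.+1 j.
  by move=> hi hj oj; rewrite hL // oj mul1r.
have useR i j : (i < n)%N -> (j.+1 < n)%N -> odd j ->
    g i j.+1 = ((0 < i)%N && ~~ odd i)%:R * g i.-1 j.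
  by move=> hi hj oj; rewrite hR //; [rewrite oj hj mul1r | lia].
(* c(p,q) is also the coefficient of x m_(2+2q) in E(x m_(2+2p)) *)
have diag p q : (p < k)%N -> (q < k)%N ->
    g (2 * p)%N (2 * q)%N = g (2 * p).+1 (2 * q).+1.
  move=> hp hq; rewrite (useL (2 * p)%N (2 * q).+1) ?mul1r //; try lia.
  rewrite (_ : _ && _ = true) ?mul1r //; lia.
have step p q : (p < k)%N -> (q < k)%N ->
    g (2 * p.+1)%N (2 * q.+1)%N = g (2 * p)%N (2 * q)%N.
  move=> hp hq; rewrite [RHS]diag //.
  rewrite (_ : 2 * q.+1 = (2 * q).+1.+1)%N; last lia.
  rewrite useR; try lia.
  rewrite (_ : _ && _ = true) ?mul1r; last lia.
  by congr g; lia.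
have offd p q : (p <= k)%N -> (q <= k)%N -> (p < q)%N ->
    g (2 * p)%N (2 * q)%N = 0.
  elim: p q => [|p IH] [//|q] hp hq hpq; last by rewrite step ?IH //; lia.
  rewrite (_ : 2 * q.+1 = (2 * q).+1.+1)%N; last lia.
  rewrite useR; try lia.
  by rewrite muln0 mul0r.
have offd' d p q : (p + d = k)%N -> (q < p)%N -> g (2 * p)%N (2 * q)%N = 0.
  elim: d p q => [|d IH] p q hp hq; last by rewrite -step ?IH //; lia.
  rewrite (useL (2 * p)%N (2 * q).+1); try lia.
  by rewrite (_ : _ && _ = false) ?mul0r //; lia.
have ond p : (p <= k)%N -> g (2 * p)%N (2 * p)%N = g 0%N 0%N.
  by elim: p => [//|p IH] hp; rewrite step ?IH //; lia.
(* odd basis vectors, being multiples of x, map to odd ones *)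
have oddev p q : (p < k)%N -> (q <= k)%N -> g (2 * p).+1 (2 * q)%N = 0.
  case: (ltnP q k) => hq hp hq'.
    rewrite (useL (2 * p).+1 (2 * q).+1); try lia.
    by rewrite (_ : _ && _ = false) ?mul0r //; lia.
  case: q hq hq' => [|q] hq hq'; first by lia.
  rewrite (_ : 2 * q.+1 = (2 * q).+1.+1)%N; last lia.
  rewrite useR; try lia.
  by rewrite (_ : _ && _ = false) ?mul0r //; lia.
pose c := g 0%N 0%N.
have key (i j : 'I_n) : ~~ (~~ odd i && odd j) -> E i j = (i == j)%:R * c.
  have hi := ltn_ord i; have hj := ltn_ord j.
  rewrite gE -val_eqE /= => h.
  have Di := odd_double_half i; have Dj := odd_double_half j.
  move: h; case oi : (odd i); case oj : (odd j) => // _; rewrite oi oj in Di Dj.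
  - have -> : (i : nat) = (2 * i./2).+1 by lia.
    have -> : (j : nat) = (2 * j./2).+1 by lia.
    rewrite -diag; try lia.
    case: (ltngtP i./2 j./2) => h.
    + rewrite offd; try lia. by rewrite (_ : _ == _ = false) ?mul0r //; lia.
    + rewrite (offd' (k - i./2)%N); try lia.
      by rewrite (_ : _ == _ = false) ?mul0r //; lia.
    + rewrite h ond; last lia. by rewrite eqxx mul1r.
  - have -> : (i : nat) = (2 * i./2).+1 by lia.
    have -> : (j : nat) = (2 * j./2)%N by lia.
    rewrite oddev; try lia. by rewrite (_ : _ == _ = false) ?mul0r //; lia.
  - have -> : (i : nat) = (2 * i./2)%N by lia.
    have -> : (j : nat) = (2 * j./2)%N by lia.
    case: (ltngtP i./2 j./2) => h.
    + rewrite offd; try lia. by rewrite (_ : _ == _ = false) ?mul0r //; lia.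
    + rewrite (offd' (k - i./2)%N); try lia.
      by rewrite (_ : _ == _ = false) ?mul0r //; lia.
    + rewrite h ond; last lia. by rewrite eqxx mul1r.
have [N eE N0] : exists2 N : 'M_n, E = c%:M + N &
    forall i j : 'I_n, ~~ (~~ odd i && odd j) -> N i j = 0.
  exists (E - c%:M) => [|i j h]; first by rewrite addrC subrK.
  by rewrite !mxE key // mulr_natl subrr.
have NN : N *m N = 0.
  apply/matrixP=> i j; rewrite !mxE big1 // => l _.
  case: (boolP (odd l)) => ol; last by rewrite N0 ?mul0r // negb_and ol orbT.
  by rewrite (N0 l) ?mulr0 // negb_and ol.
have eq2 : c * c - c = 0 /\ (c *+ 2 - 1) *: N = 0.
  have e : (c * c - c)%:M + (c *+ 2 - 1) *: N = 0.
    have e1 : E *m E = (c * c)%:M + (c *+ 2) *: N.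
      rewrite eE mulmxDl !mulmxDr NN addr0 -scalar_mxM mul_scalar_mx.
      by rewrite mul_mx_scalar -addrA -scalerDl mulr2n.
    rewrite scalerBl scale1r raddfB /= addrACA -opprD -e1 -eE EE.
    by rewrite subrr.
  have cc : c * c - c = 0.
    have := congr1 (fun M : 'M_n => M ord0 ord0) e.
    by rewrite !mxE N0 //= mulr0 addr0 mulr1n.
  by move: e; rewrite cc raddf0 add0r.
case: eq2 => /eqP; rewrite -{3}[c]mulr1 -mulrBr mulf_eq0 => /orP[/eqP c0|].
  rewrite c0 mul0rn sub0r scaleN1r => /eqP; rewrite oppr_eq0 => /eqP n0.
  by left; rewrite eE n0 c0 raddf0 addr0.
rewrite subr_eq0 => /eqP c1; rewrite c1 mulr2n addrK scale1r => n0.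
by right; rewrite eE n0 c1 addr0.
Qed.

End Strings.

(** * Unit maps and their splittings *)

Section Splits.
Variable K : fieldType.
Implicit Types F G H : endofunctor K.
Local Notation regD := (regD K).
Local Notation rho := (rho K).

Definition left_mod (U : bimod K) : dmod K := DMod (lact_sq U).
Definition right_mul (U : bimod K) : dhom (left_mod U) (left_mod U) :=
  @DHom K (left_mod U) (left_mod U) (ract U) (lract_comm U).
Definition tens_in_hom U : dhom (left_mod U) (tens U regD) :=
  @DHom K (left_mod U) (tens U regD) _ (tens_in_lact U).
Definition tens_out_hom U : dhom (tens U regD) (left_mod U) :=
  @DHom K (tens U regD) (left_mod U) _ (tens_out_lact U).

Lemma tens_xactE (U : bimod K) (X : dmod K) :
  cokproj (trel U X) *m xact (tens_obj U X) =
  (lact U *t 1%:M) *m cokproj (trel U X).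
Proof. exact: cokmapE (trel_lact U X). Qed.

Section Central.
Variables (W : bimod K) (u : 'rV[K]_(bdim W)).
Local Notation gen_u := (gen (u : 'rV_(dim (left_mod W)))).
Hypothesis u_central : u *m lact W = u *m ract W.

Definition central_hom : dhom regD (tens W regD) :=
  dcomp (tens_in_hom W) (gen (u : 'rV_(dim (left_mod W)))).

Fact central_rho :
  fmap fid rho *m central_hom = central_hom *m fmap (tens W) rho.
Proof.
rewrite -[LHS]/(rho *m (gen_u *m tens_in W)).
rewrite -[RHS]/(gen_u *m tens_in W *m fmap (tens W) rho).
rewrite mulmxA rho_gen -(mulmxA _ (tens_in W)) -tens_in_ract mulmxA.
congr (_ *m _).
have -> : u *m xact (left_mod W) = u *m right_mul W by exact: u_central.
have e := esym (gen_comp (u : 'rV_(dim (left_mod W))) (right_mul W)).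
exact: (congr1 (@hom_mx K regD (left_mod W)) e).
Qed.
(** The 2-morphism 1 -> W given by the bimodule map D -> W, 1 |-> u. *)
Definition unit_map : nattrans fid (tens W) :=
  extension (@right_exact_id K) (right_exact_tens W) central_rho.

Section Action.
(* [Xi] is a bimodule map from W to the left linear endomorphisms of V, with
   (x f)(v) = f(v x) and (f x)(v) = f(v) x, that sends u to the identity *)
Variables (V : bimod K) (Xi : 'I_(bdim W) -> 'M[K]_(bdim V)).
Hypothesis Xi_balanced : forall j, ract V *m Xi j = \sum_l lact W j l *: Xi l.
Hypothesis Xi_lact : forall j, lact V *m Xi j = Xi j *m lact V.
Hypothesis Xi_ract : forall j, \sum_l ract W j l *: Xi l = Xi j *m ract V.
Hypothesis Xi_u : \sum_j u 0 j *: Xi j = 1%:M.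

Local Notation T := (trel V (left_mod W)).
(** The adjoint of [Xi], v (x) w |-> Xi_w(v), on V (x)_D W. *)
Definition pairing_mx := pinvmx (cokproj T) *m stack Xi.

Lemma cokproj_pairing : cokproj T *m pairing_mx = stack Xi.
Proof.
apply: cokprojK; rewrite mulmxBl tensl_stack tensr_stack stackB.
apply: tinj_ext => j; rewrite mulmx0.
rewrite (tinj_stack (fun j => ract V *m Xi j - \sum_l lact W j l *: Xi l)).
by rewrite Xi_balanced subrr.
Qed.

Fact pairing_mx_comm :
  xact (tens_obj V (left_mod W)) *m pairing_mx = pairing_mx *m lact V.
Proof.
have eA := cokproj_pairing; move: pairing_mx eA => A eA.
apply: (cokernel_epi (cokernel_cokproj T)); rewrite [LHS]mulmxA [RHS]mulmxA eA.
rewrite tens_xactE -mulmxA eA tensl_stack stack_mul.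
exact: eq_stack.
Qed.

Definition pairing_hom : dhom (tens V (tens W regD)) (tens V regD) :=
  dcomp (tens_in_hom V)
    (dcomp (@DHom K (tens_obj V (left_mod W)) (left_mod V) _ pairing_mx_comm)
      (tens_hom V (tens_out_hom W))).

Let Vout := tens_hom V (tens_out_hom W).
Let Vright := tens_hom V (right_mul W).

Lemma pairing_mx_ract : Vright *m pairing_mx = pairing_mx *m ract V.
Proof.
have eA := cokproj_pairing; move: pairing_mx eA => A eA.
apply: (cokernel_epi (cokernel_cokproj T)); rewrite [LHS]mulmxA [RHS]mulmxA eA.
rewrite (tens_homE V (right_mul W)) -mulmxA eA tensr_stack stack_mul.
exact: eq_stack.
Qed.

Lemma tens_out_right :
  fmap (tens V) (fmap (tens W) rho) *m Vout = Vout *m Vright.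
Proof.
have e : dcomp (tens_out_hom W) (fmap (tens W) rho) =
         dcomp (right_mul W) (tens_out_hom W).
  by apply: dhom_inj; apply: tens_out_ract.
have := congr1 (@fmap _ (tens V) _ _) e.
by rewrite !fmap_comp => /(congr1 (@hom_mx _ _ _)).
Qed.

Fact pairing_rho : fmap (fcomp (tens V) (tens W)) rho *m pairing_hom =
  pairing_hom *m fmap (tens V) rho.
Proof.
exact: intertwine_comp tens_out_right pairing_mx_ract (tens_in_ract V).
Qed.

(** The pairing sends v (x) u to Xi_u(v) = v, so it splits v |-> v (x) u; by
    [nattrans_regD_inj] this check at D is enough. *)
Lemma whisker_split : left_split (whisker (tens V) unit_map).
Proof.
have rVW := right_exact_comp (right_exact_tens V) (right_exact_tens W).
pose xi := extension rVW (right_exact_tens V) pairing_rho.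
exists xi => X; apply: dhom_inj.
apply: (@nattrans_regD_inj K _ _ (vcomp xi (whisker (tens V) unit_map))
  (nid _)); first exact: right_exact_tens.
have exi : xi regD = pairing_hom by apply: extension_regD.
have epsi : unit_map regD = central_hom by apply: extension_regD.
rewrite -[LHS]/(fmap (tens V) (unit_map regD) *m xi regD) exi epsi.
have -> : fmap (tens V) central_hom *m pairing_hom =
    tens_hom V gen_u *m pairing_mx *m tens_in V.
  have e : fmap (tens V) central_hom *m Vout =
           tens_hom V gen_u.
    rewrite -[LHS]/(hom_mx (dcomp Vout (fmap (tens V) central_hom))).
    rewrite -[Vout]/(fmap (tens V) (tens_out_hom W)) -fmap_comp.
    congr (hom_mx (fmap (tens V) _)); apply: dhom_inj.
    rewrite -[LHS]/(gen_u *m tens_in W *m tens_out W).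
    by rewrite -mulmxA tens_inK mulmx1.
  rewrite -[pairing_hom : 'M_(_, _)]/(Vout *m pairing_mx *m tens_in V) -e.
  by move: (hom_mx _) (hom_mx _) => A B; rewrite !mulmxA.
have e : tens_in V *m tens_hom V gen_u *m pairing_mx = 1%:M.
  apply: etrans (mul_square _ (tens_homE V gen_u) cokproj_pairing) _.
  rewrite tinj_tensr mulmx_suml -Xi_u.
  apply: eq_bigr => j _; rewrite -scalemxAl tinj_stack.
  have /rowP/(_ j) := e0_gen (u : 'rV_(dim (left_mod W))).
  by rewrite -rowE mxE => ->.
exact: conj_id (tens_outK V) e.
Qed.
End Action.
End Central.

(** * Co-goodness and co-greatness *)

Lemma left_split_iso F G H (psi : nattrans fid H) :
  fiso F G -> left_split (whisker G psi) -> left_split (whisker F psi).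
Proof.
case/fiso_retract=> a [b [ab _]] [xi exi].
pose aH : nattrans (fcomp F H) (fcomp G H) :=
  @NatTrans K (fcomp F H) (fcomp G H) (fun X => a (H X))
    (fun X Y f => natural a (fmap H f)).
exists (vcomp b (vcomp xi aH)) => X; apply: dhom_inj.
rewrite -[LHS]/(fmap F (psi X) *m (a (H X) *m xi X *m b X)) !mulmxA natE.
have /(congr1 (@hom_mx _ _ _)) /= e := exi X.
by rewrite -(mulmxA (a X)) e mulmx1 ab.
Qed.

(** If H' is co-good via psi', a splitting xi : H H' -> H of H psi' exists since
    H is in [L].  Put gamma = xi o (psi H').  The interchange law rewrites
    (psi H') o psi' as (H psi') o psi, and xi cancels H psi'. *)
Lemma co_good_member_co_great (C L : endofunctor K -> Prop) H
    (psi : nattrans fid H) :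
  co_good_via C L psi -> L H -> co_great C L H.
Proof.
move=> good LH; exists psi; split=> // H' psi' [_ /(_ _ LH)[xi exi]].
pose psiH' : nattrans H' (fcomp H H') :=
  @NatTrans K H' (fcomp H H') (fun X => psi (H' X))
    (fun X Y f => natural psi (fmap H' f)).
exists (vcomp xi psiH') => X; apply: dhom_inj.
rewrite -[RHS]/(psi' X *m (psi (H' X) *m xi X)) mulmxA.
have /(congr1 (@hom_mx _ _ _)) /= -> := natural psi (psi' X).
have /(congr1 (@hom_mx _ _ _)) /= e := exi X.
by rewrite -mulmxA e mulmx1.
Qed.

Definition W_unit m : nattrans fid (tens (Wk K m)) :=
  @unit_map (Wk K m) _ (diag_vec_central K m).

Lemma W_unit_split n m : (n <= 2 * m + 2)%N ->
  left_split (whisker (tens (string_bimod K 2 n)) (W_unit m)).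
Proof.
move=> le_nm; apply: (@whisker_split (Wk K m) _ _ (string_bimod K 2 n)
  (fun j => act_mx K n j)).
- exact: act_ract.
- exact: act_lact.
- exact: act_ract_right.
- exact: act_diag_vec.
Qed.

(** * Membership of W_k in the 2-subcategory *)

Definition dhom0 (X Y : dmod K) : dhom X Y :=
  @DHom K X Y 0 (etrans (mulmx0 _ _) (esym (mul0mx _ _))).
Fact nzero_natural F G X Y (f : dhom X Y) :
  dcomp (dhom0 (F Y) (G Y)) (fmap F f) = dcomp (fmap G f) (dhom0 (F X) (G X)).
Proof. by apply: dhom_inj; rewrite /= mulmx0 mul0mx. Qed.
Definition nzero F G : nattrans F G := NatTrans (@nzero_natural F G).

Lemma fiso_zero F : (forall X, 1%:M = 0 :> 'M[K]_(dim (F X))) -> fiso F fzero.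
Proof.
move=> F0.
exists (nzero _ _), (nzero _ _) => X; split; apply: dhom_inj => /=.
  by rewrite mulmx0 F0.
by rewrite mulmx0; apply/matrixP=> - [].
Qed.

(** If W_k is the sum of A and B, the projection [p] onto A is an idempotent of
    W_k, so it is 0 or 1 at D and hence everywhere; then A or B vanishes. *)
Lemma indecomposable_W k : indecomposable (tens (Wk K k)).
Proof.
have rW := right_exact_tens (Wk K k); split; first exact: right_exact_one_mor.
  case/fiso_retract=> a [b [ab _]].
  have e : (1%:M : 'M[K]_(2 * k + 1)) = 0.
    rewrite -[LHS](tens_inK (Wk K k)) -[tens_in _]mulmx1 -(ab regD).
    rewrite (_ : hom_mx (a regD) = 0); last by apply/matrixP=> ? [].
    by rewrite mul0mx mulmx0 mul0mx.
  have lt0 : (0 < 2 * k + 1)%N by rewrite addn1.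
  pose i0 := Ordinal lt0.
  have /eqP := congr1 (fun M : 'M_(2 * k + 1) => M i0 i0) e.
  by rewrite !mxE eqxx oner_eq0.
move=> A B _ _ /fiso_retract[a [b [ab ba]]].
pose pA := ncopair (nid A) (nzero B A); pose iA := npair (nid A) (nzero A B).
pose pB := ncopair (nzero A B) (nid B); pose iB := npair (nzero B A) (nid B).
have iApA X : iA X *m pA X = 1%:M by rewrite /= mul_row_col mulmx1 mulmx0 addr0.
have iBpB X : iB X *m pB X = 1%:M by rewrite /= mul_row_col mulmx1 mulmx0 add0r.
have iApB X : iA X *m pB X = 0 by rewrite /= mul_row_col mulmx0 mul0mx addr0.
pose p := vcomp (vcomp b iA) (vcomp pA a).
have pE X : p X = a X *m pA X *m (iA X *m b X) :> 'M_(_, _) by [].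
have pp X : p X *m p X = p X.
  rewrite !pE !mulmxA -(mulmxA _ (b X) (a X)) ba mulmx1.
  rewrite -(mulmxA _ (iA X) (pA X)) iApA.
  by rewrite mulmx1.
pose W := Wk K k; pose P := p regD; pose E := tens_in W *m P *m tens_out W.
have EL : lact W *m E = E *m lact W.
  exact: intertwine_comp (tens_in_lact W) (hom_comm P) (tens_out_lact W).
have ER : ract W *m E = E *m ract W.
  exact: intertwine_comp (tens_in_ract W) (natE p rho) (tens_out_ract W).
have EE : E *m E = E by exact: conj_idem (tens_outK W) (pp regD).
have [E0|E1] := W_idempotent (addn1 (2 * k)) EL ER EE.
  left; apply: fiso_zero => X.
  have p0 : p X = 0 :> 'M_(_, _).
    apply: (nattrans_regD_inj (b := nzero _ _)) => //.
    exact: conj_eq0 (tens_outK W) E0.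
  have <- : iA X *m (b X *m p X *m a X) *m pA X = 1%:M.
    rewrite pE !mulmxA -!(mulmxA _ (b X) (a X)) ba !mulmx1.
    by rewrite -!(mulmxA _ (iA X) (pA X)) iApA mulmx1.
  by rewrite p0 mulmx0 mul0mx mulmx0 mul0mx.
right; apply: fiso_zero => X.
have p1 : p X = 1%:M :> 'M_(_, _).
  apply: (nattrans_regD_inj (b := nid _)) => //.
  exact: conj_eq1 (tens_outK W) E1.
have : iB X *m (b X *m p X *m a X) *m pB X = 0.
  rewrite pE !mulmxA -!(mulmxA _ (b X) (a X)) ba !mulmx1.
  by rewrite -(mulmxA _ (iA X) (pB X)) iApB mulmx0.
by rewrite p1 mulmx1 ba mulmx1 iBpB.
Qed.

(** W_k is a direct summand of W_k W_m, through the unit map of W_m. *)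
Lemma leJ_W k m : (k <= m)%N -> leJ (tens (Wk K m)) (tens (Wk K k)).
Proof.
move=> le_km; exists (tens (Wk K k)), fid.
have rW j := right_exact_tens (Wk K j).
pose G := fcomp (tens (Wk K k)) (fcomp (tens (Wk K m)) fid).
split; [exact/right_exact_one_mor/rW | |].
  exact/right_exact_one_mor/right_exact_id.
have [xi exi] : left_split (whisker (tens (Wk K k)) (W_unit m)).
  by apply: W_unit_split; lia.
pose i := whisker (tens (Wk K k)) (W_unit m).
apply: (@summand_retract _ _ G (@NatTrans K _ G i (natural i))
  (@NatTrans K G _ xi (natural xi))).
  by apply: right_exact_comp => //; apply: right_exact_comp.
by move=> X; have /(congr1 (@hom_mx _ _ _)) := exi X.
Qed.

Lemma fiso_fsum1 F : fiso F (fsum [:: F]).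
Proof.
exists (npair (nid F) (nzero F fzero)), (ncopair (nid F) (nzero fzero F)).
move=> X; split; apply: dhom_inj => /=.
  by rewrite mul_row_col mulmx1 mulmx0 addr0.
rewrite mul_col_row mulmx1 !mulmx0 mul0mx scalar_mx_block.
by congr block_mx; apply/matrixP=> - [].
Qed.

Lemma Dm_W k m : (k <= m)%N -> Dm m (tens (Wk K k)).
Proof.
move=> le_km; split; first exact/right_exact_one_mor/right_exact_tens.
exists [:: tens (Wk K k)]; split; last exact: fiso_fsum1.
move=> i; have -> : (i : nat) = 0%N by case: i => [[]].
left; split; first exact: indecomposable_W.
exists (tens (Wk K m)); last exact: leJ_W.
by apply: Or41; apply: fiso_refl.
Qed.

End Splits.

Theorem proposition15 (K : closedFieldType) (hchar : [pchar K] =i pred0)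
    (m k : nat) (hk : (1 <= k)%N) (hkm : (k <= m)%N) :
  co_great (@Dm K m) (@cellL_WS K k) (tens (Wk K k)).
Proof.
apply: (@co_good_member_co_great K _ _ _ (W_unit K k)); last first.
  by left; apply: fiso_refl.
split=> [|F [] isoF]; first exact: Dm_W.
  by apply: left_split_iso isoF _; apply: W_unit_split; lia.
by apply: left_split_iso isoF _; apply: W_unit_split.
Qed.
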